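(* Let $N\ge3$ and let $K\subset\mathbb{R}^N$ be a nonempty compact set with finitely many components, $K=K_1\cup K_2$, where $K_1$ is the union of all components of $K$ which are the closure of a $C^2$ domain and $K_2$ is the set of all isolated points of $K$. Let $\alpha<0<p$ and consider the inequality $$-\Delta u\ge\delta_K^\alpha(x)u^{-p}\quad\text{in }\mathbb{R}^N\setminus K.\qquad(\ast)$$ (i) If $K_1$ is nonempty, then $(\ast)$ has no positive $C^2$ solutions. (ii) If $K_1=\emptyset$, then $(\ast)$ has positive $C^2$ solutions if and only if $$N+\alpha+p(N-2)>0\quad\text{and}\quad\alpha<-2,$$ and all solutions of $(\ast)$ are singular at points of $K_2$.
   Context: $\delta_K(x)=\mathrm{dist}(x,\partial K)$ and $\delta_K^\alpha(x)=(\delta_K(x))^\alpha$. Solutions are positive functions $u\in C^2(\mathbb{R}^N\setminus K)$ satisfying the inequality pointwise. ''Singular at a point of $K_2$'' means that the solution cannot be extended continuously to that point (the isolated singularity is not removable). *)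

(* Defs.v *)
From HB Require Import structures.
From mathcomp Require Import all_boot all_order all_algebra.
From mathcomp Require Import all_classical all_reals all_analysis.

Set Implicit Arguments.
Unset Strict Implicit.
Unset Printing Implicit Defensive.

Import Order.TTheory GRing.Theory Num.Theory.
Import numFieldNormedType.Exports.

Local Open Scope classical_set_scope.
Local Open Scope ring_scope.

(* R^n is 'rV[R]_n.  Its library topology is the usual one, but its library
   norm `|x| is the sup norm, so the Euclidean norm is defined here. *)
Definition eucl_norm (R : realType) (n : nat) (x : 'rV[R]_n) : R :=
  Num.sqrt (\sum_(i < n) x ord0 i ^+ 2).

Definition boundary (T : topologicalType) (A : set T) : set T :=
  closure A `\` interior A.

(* Euclidean distance from x to A, meant for nonempty A. *)
Definition dist_to (R : realType) (n : nat) (A : set 'rV[R]_n) (x : 'rV[R]_n) : R :=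
  inf [set eucl_norm (x - y) | y in A].

Definition delta (R : realType) (n : nat) (K : set 'rV[R]_n) (x : 'rV[R]_n) : R :=
  dist_to (boundary K) x.

Definition partial (R : realType) (n : nat) (i : 'I_n) (f : 'rV[R]_n -> R) :
    'rV[R]_n -> R :=
  fun x => 'D_(delta_mx ord0 i) f x.

Definition laplacian (R : realType) (n : nat) (f : 'rV[R]_n -> R) (x : 'rV[R]_n) : R :=
  \sum_(i < n) partial i (partial i f) x.

(* Functions on U are represented by total functions; the predicates below are
   meant for open U and then depend only on the values of f on U. *)
Definition C0_on (R : realType) (n : nat) (U : set 'rV[R]_n) (f : 'rV[R]_n -> R) :=
  forall x, U x -> {for x, continuous f}.

Definition C1_on (R : realType) (n : nat) (U : set 'rV[R]_n) (f : 'rV[R]_n -> R) :=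
  C0_on U f /\
  forall i : 'I_n,
    (forall x, U x -> derivable f x (delta_mx ord0 i)) /\ C0_on U (partial i f).

Definition C2_on (R : realType) (n : nat) (U : set 'rV[R]_n) (f : 'rV[R]_n -> R) :=
  C1_on U f /\ forall i : 'I_n, C1_on U (partial i f).

(* Near each boundary point, up to relabelling and reversing one coordinate
   axis, D is the strict epigraph of a C^2 function of the other coordinates
   (col' i x is x with its i-th coordinate removed). *)
Definition C2_domain (R : realType) (n : nat) (D : set 'rV[R]_n) : Prop :=
  [/\ open D, connected D, D !=set0 &
      forall z, boundary D z ->
        exists (i : 'I_n) (b : bool) (g : 'rV[R]_n.-1 -> R),
          C2_on [set: 'rV[R]_n.-1] g /\
          \forall x \near z, D x <-> g (col' i x) < (-1) ^+ b * x ord0 i].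

Definition components (T : topologicalType) (A : set T) : set (set T) :=
  [set connected_component A x | x in A].

Definition C2_part (R : realType) (n : nat) (K : set 'rV[R]_n) : set 'rV[R]_n :=
  \bigcup_(C in [set C | components K C /\
                         exists2 D, C2_domain D & C = closure D]) C.

Definition positive_C2_solution (R : realType) (n : nat) (K : set 'rV[R]_n)
    (alpha p : R) (u : 'rV[R]_n -> R) : Prop :=
  [/\ C2_on (~` K) u,
      forall x, ~ K x -> 0 < u x &
      forall x, ~ K x -> delta K x `^ alpha * u x `^ (- p) <= - laplacian u x].

(* The restriction of u to the complement of K has no continuous extension
   to the point a; meant for isolated points a of K. *)
Definition singular_at (R : realType) (n : nat) (K : set 'rV[R]_n)
    (u : 'rV[R]_n -> R) (a : 'rV[R]_n) : Prop :=
  ~ exists v : 'rV[R]_n -> R,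
      (forall x, ~ K x -> v x = u x) /\ {for a, continuous v}.

(* Main.v *)
Require Import Defs.
From HB Require Import structures.
From mathcomp Require Import all_boot all_order all_algebra.
From mathcomp Require Import all_classical all_reals all_analysis.
From mathcomp Require Import ring lra.

Set Implicit Arguments.
Unset Strict Implicit.
Unset Printing Implicit Defensive.

Import Order.TTheory GRing.Theory Num.Theory.
Import numFieldNormedType.Exports.

Local Open Scope classical_set_scope.
Local Open Scope ring_scope.

(** Everything follows from the maximum principle ([comparison]) applied to
explicit barriers.  Let [u] be a solution and let [w] be a C^2 function that is
bounded above, say by [M], and at most 0 on the boundary of a compact set [E]
disjoint from [K].  If [w <= u] fails somewhere in [E], then [u - w] has a
negative minimum inside [E]; there [- laplacian w >= - laplacian u], while
[u < w <= M] turns the differential inequality into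
[- laplacian u >= delta^alpha M^(-p)].  So [w <= u] as soon as
[- laplacian w < delta^alpha M^(-p)]; the point is that an upper bound on the
barrier replaces the missing upper bound on [u].  In the first, second and
fourth barrier below, a harmonic function scaled to exceed [u] at one given
point is corrected by a small logarithmic term, which makes the barrier
negative near the singular part of the boundary; in the third, where [u] is
bounded by assumption, the logarithm and the harmonic function exchange roles.

With [q] the squared Euclidean distance to a point [a], [s = q^(1 - N/2)] the
fundamental solution, [A] a positive constant depending on the value of [u] at
the given point, and [k] a small positive constant:
- near infinity, [w = A (s0 - s - k ln (q / q0))] forces [alpha < -2]
  ([solution_alpha_ltN2]);
- near an isolated point of [K], [w = A (s - s0 + k s ln q)] forces
  [N + alpha + p (N - 2) > 0] ([solution_exponent_gt0]); here the contact bound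
  is [u < w <= A s];
- near an isolated point around which [u] is bounded by [M], the barrier
  [w = B ln (q0 / q) - k (s - s0)] with fixed small [B] and arbitrarily small
  [k] shows that [u] is unbounded when [alpha <= -2] ([solution_unbounded]),
  hence the singularity is not removable;
- near a point where [K] is the closure of a C^2 domain, let [tau] be the
  distance, along the distinguished axis, from a point outside the domain to
  the graph describing the boundary, so that [delta <= tau].  With
  a centre [a] slightly inside the domain, [w = A (s - s1 + k ln tau)] rules out
  all solutions when [alpha <= -2] ([no_solution_barrier],
  [no_solution_C2_component]).  As [alpha < -2] was already forced by the
  behaviour at infinity, no solution exists as soon as [K] has such a
  component.

Conversely, when all points of [K] are isolated, [K] is finite and
[u = C sum_(a in K) |x - a|^(-gamma)], with [gamma = - (alpha + 2) / (1 + p)],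
is a solution for large [C]; the two conditions say exactly that
[0 < gamma < N - 2] ([solution_exists]). *)

(** * Calculus of C^2 functions and of the Laplacian *)

(** A directional derivative is the derivative of the restriction to a line;
this reduces partial derivatives to one-variable calculus. *)
Lemma is_derive_lineP (R : realType) (V : normedModType R) (f : V -> R)
    (x v : V) (df : R) :
  is_derive x v f df <->
  is_derive (0 : R) 1 (fun h : R => f (h *: v + x)) df.
Proof.
have E : 'D_v f x = 'D_1 (fun h : R => f (h *: v + x)) 0.
  rewrite /derive; set g1 := fun h => h^-1 *: _; set g2 := fun h => h^-1 *: _.
  suff -> : g1 = g2 by [].
  by rewrite funeqE /g1 /g2 => h /=; rewrite addr0 scale0r add0r [_%:A]mulr1.
split=> -[fx dfE].
  by split; [exact/(derivable1P f x v).1|rewrite -E].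
by split; [exact/(derivable1P f x v).2|rewrite E].
Qed.

Lemma is_derive_comp1 (R : realType) (V : normedModType R) (f : V -> R)
    (phi : R -> R) (x v : V) (df dphi : R) :
  is_derive x v f df -> is_derive (f x) 1 phi dphi ->
  is_derive x v (fun y => phi (f y)) (dphi * df).
Proof.
move=> /is_derive_lineP fx phix; apply/is_derive_lineP.
have phix' : is_derive ((fun h : R => f (h *: v + x)) 0) 1 phi dphi.
  by rewrite scale0r add0r.
by have := is_derive1_comp phix' fx; rewrite mulrC.
Qed.

Section C2_calculus.
Context {R : realType} {n : nat}.
Implicit Types (U : set 'rV[R]_n) (f g : 'rV[R]_n -> R) (i : 'I_n).

Local Notation e_ i := (delta_mx ord0 i : 'rV[R]_n).

Lemma C0_on_ext U f g : open U -> (forall x, U x -> f x = g x) ->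
  C0_on U f -> C0_on U g.
Proof.
move=> oU fg cf x Ux; rewrite /prop_for /continuous_at -fg//.
have nU : nbhs x U by exact: open_nbhs_nbhs.
apply: cvg_trans (cf x Ux); apply: (@near_eq_cvg _ _ (nbhs x)).
by apply: (filterS _ nU) => y /fg.
Qed.

Lemma is_derive_ext_on U f g x v df : open U ->
  (forall y, U y -> f y = g y) -> U x ->
  is_derive x v f df -> is_derive x v g df.
Proof.
move=> oU fg Ux; apply: near_eq_is_derive.
have nU : nbhs x U by exact: open_nbhs_nbhs.
by apply: (filterS _ nU) => y /fg.
Qed.

Lemma C0_onD U f g : C0_on U f -> C0_on U g -> C0_on U (fun x => f x + g x).
Proof. by move=> cf cg x Ux; exact: continuousD (cf x Ux) (cg x Ux). Qed.

Lemma C0_onM U f g : C0_on U f -> C0_on U g -> C0_on U (fun x => f x * g x).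
Proof. by move=> cf cg x Ux; exact: continuousM (cf x Ux) (cg x Ux). Qed.

Lemma C0_on_sum (I : Type) (r : seq I) U (F : I -> 'rV[R]_n -> R) :
  (forall j, C0_on U (F j)) -> C0_on U (fun x => \sum_(j <- r) F j x).
Proof.
move=> CF; elim: r => [|j r IH].
  by under eq_fun do rewrite big_nil; move=> x _; exact: cst_continuous.
under eq_fun do rewrite big_cons.
exact: C0_onD (CF j) IH.
Qed.

Lemma C0_on_comp U f (phi : R -> R) : C0_on U f ->
  (forall x, U x -> {for f x, continuous phi}) ->
  C0_on U (fun x => phi (f x)).
Proof.
move=> cf cphi x Ux; exact: (@continuous_comp _ _ _ f phi x (cf x Ux) (cphi x Ux)).
Qed.

(** C^1 regularity from candidate partial derivatives, which avoids unfolding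
[partial]; see also [C2_on_intro]. *)
Lemma C1_on_intro U f (df : 'I_n -> 'rV[R]_n -> R) : open U -> C0_on U f ->
  (forall i x, U x -> is_derive x (e_ i) f (df i x)) ->
  (forall i, C0_on U (df i)) -> C1_on U f.
Proof.
move=> oU cf fdf cdf; split=> // i; split=> [x Ux|].
  by have [] := fdf i x Ux.
by apply: C0_on_ext (cdf i) => // x Ux; have [_ <-] := fdf i x Ux.
Qed.

Lemma C1_on_is_derive U f i x : C1_on U f -> U x ->
  is_derive x (e_ i) f (partial i f x).
Proof. by move=> [_ /(_ i)[+ _]] Ux => /(_ x Ux)/derivableP. Qed.

Lemma C1_on_ext U f g : open U -> (forall x, U x -> f x = g x) ->
  C1_on U f -> C1_on U g.
Proof.
move=> oU fg Cf; apply: (@C1_on_intro U g (fun i => partial i f)).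
- exact: oU.
- by case: Cf => cf _; exact: C0_on_ext cf.
- by move=> i x Ux; exact: (is_derive_ext_on oU fg Ux (C1_on_is_derive i Cf Ux)).
- by case: Cf => _ + i => /(_ i)[].
Qed.

Lemma C2_on_intro U f (df : 'I_n -> 'rV[R]_n -> R) : open U -> C0_on U f ->
  (forall i x, U x -> is_derive x (e_ i) f (df i x)) ->
  (forall i, C1_on U (df i)) -> C2_on U f.
Proof.
move=> oU cf fdf cdf; split=> [|i].
  exact: (@C1_on_intro U f df oU cf fdf (fun i => (cdf i).1)).
by apply: C1_on_ext (cdf i) => // x Ux; have [_ <-] := fdf i x Ux.
Qed.

Lemma C1_onW U V f : V `<=` U -> C1_on U f -> C1_on V f.
Proof.
move=> VU [cf df]; split=> [x /VU|i]; first exact: cf.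
by have [dfi cfi] := df i; split=> x /VU; [exact: dfi|exact: cfi].
Qed.

Lemma C2_onW U V f : V `<=` U -> C2_on U f -> C2_on V f.
Proof. by move=> VU [f1 f2]; split=> [|i]; apply: C1_onW VU _. Qed.

Lemma C1_on_cst U (c : R) : open U -> C1_on U (cst c).
Proof.
move=> oU; apply: (@C1_on_intro _ _ (fun _ _ => 0)).
- exact: oU.
- by move=> x _; exact: cst_continuous.
- by move=> i x _; exact: cst_continuous.
Qed.

Lemma C1_onD U f g : open U -> C1_on U f -> C1_on U g ->
  C1_on U (fun x => f x + g x).
Proof.
move=> oU Cf Cg.
apply: (@C1_on_intro _ _ (fun i x => partial i f x + partial i g x)).
- exact: oU.
- exact: C0_onD Cf.1 Cg.1.
- move=> i x Ux.
  exact: is_deriveD (C1_on_is_derive i Cf Ux) (C1_on_is_derive i Cg Ux).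
- by move=> i; exact: C0_onD (Cf.2 i).2 (Cg.2 i).2.
Qed.

Lemma C1_onM U f g : open U -> C1_on U f -> C1_on U g ->
  C1_on U (fun x => f x * g x).
Proof.
move=> oU Cf Cg; have [f0 f1] := Cf; have [g0 g1] := Cg.
apply: (@C1_on_intro _ _
  (fun i x => f x * partial i g x + g x * partial i f x)).
- exact: oU.
- exact: C0_onM.
- move=> i x Ux.
  exact: is_deriveM (C1_on_is_derive i Cf Ux) (C1_on_is_derive i Cg Ux).
- by move=> i; exact: C0_onD (C0_onM f0 (g1 i).2) (C0_onM g0 (f1 i).2).
Qed.

Lemma C1_on_comp U f (P : set R) (phi dphi : R -> R) : open U -> C1_on U f ->
  (forall x, U x -> P (f x)) ->
  (forall t, P t -> is_derive t 1 phi (dphi t)) ->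
  (forall t, P t -> {for t, continuous dphi}) ->
  C1_on U (fun x => phi (f x)).
Proof.
move=> oU Cf UP dP cP; have [f0 f1] := Cf.
have cphi t : P t -> {for t, continuous phi}.
  by move=> /dP[/derivable1_diffP/differentiable_continuous].
apply: (@C1_on_intro _ _ (fun i x => dphi (f x) * partial i f x)).
- exact: oU.
- by apply: C0_on_comp => // x Ux; exact/cphi/UP.
- move=> i x Ux; apply: is_derive_comp1 (C1_on_is_derive i Cf Ux) _.
  exact/dP/UP.
- move=> i; apply: C0_onM (f1 i).2.
  by apply: C0_on_comp => // x Ux; exact/cP/UP.
Qed.

Lemma C2_onD U f g : open U -> C2_on U f -> C2_on U g ->
  C2_on U (fun x => f x + g x).
Proof.
move=> oU [f1 f2] [g1 g2].
apply: (@C2_on_intro _ _ (fun i x => partial i f x + partial i g x)).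
- exact: oU.
- by have [] := C1_onD oU f1 g1.
- move=> i x Ux.
  exact: is_deriveD (C1_on_is_derive i f1 Ux) (C1_on_is_derive i g1 Ux).
- by move=> i; exact: C1_onD.
Qed.

Lemma C2_on_cst U (c : R) : open U -> C2_on U (cst c).
Proof.
move=> oU; apply: (@C2_on_intro _ _ (fun _ _ => 0)).
- exact: oU.
- by move=> x _; exact: cst_continuous.
- by move=> i; exact: C1_on_cst.
Qed.

Lemma C2_onZ U (c : R) f : open U -> C2_on U f -> C2_on U (fun x => c * f x).
Proof.
move=> oU [f1 f2].
apply: (@C2_on_intro _ _ (fun i x => c * partial i f x)).
- exact: oU.
- by have [] := C1_onM oU (C1_on_cst c oU) f1.
- by move=> i x Ux; exact: is_deriveZ (C1_on_is_derive i f1 Ux).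
- by move=> i; have := C1_onM oU (C1_on_cst c oU) (f2 i).
Qed.

Lemma C2_on_sum (I : eqType) (r : seq I) U (F : I -> 'rV[R]_n -> R) :
  open U -> (forall j, j \in r -> C2_on U (F j)) ->
  C2_on U (fun x => \sum_(j <- r) F j x).
Proof.
move=> oU; elim: r => [|j r IH] CF.
  by under eq_fun do rewrite big_nil; exact: C2_on_cst.
under eq_fun do rewrite big_cons.
apply: C2_onD oU (CF j (mem_head j r)) (IH _) => k kr.
by apply: CF; rewrite inE kr orbT.
Qed.

Lemma C2_on_comp U f (P : set R) (phi dphi ddphi : R -> R) : open U ->
  C2_on U f -> (forall x, U x -> P (f x)) ->
  (forall t, P t -> is_derive t 1 phi (dphi t)) ->
  (forall t, P t -> is_derive t 1 dphi (ddphi t)) ->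
  (forall t, P t -> {for t, continuous ddphi}) ->
  C2_on U (fun x => phi (f x)).
Proof.
move=> oU [f1 f2] UP d1 d2 c2.
have c1 t : P t -> {for t, continuous dphi}.
  by move=> /d2[/derivable1_diffP/differentiable_continuous].
apply: (@C2_on_intro _ _ (fun i x => dphi (f x) * partial i f x)).
- exact: oU.
- by have [] := C1_on_comp oU f1 UP d1 c1.
- move=> i x Ux; apply: is_derive_comp1 (C1_on_is_derive i f1 Ux) _.
  exact/d1/UP.
- by move=> i; apply: C1_onM => //; exact: C1_on_comp UP d2 c2.
Qed.

Lemma laplacian_is_derive U f (df : 'I_n -> 'rV[R]_n -> R) (ddf : 'I_n -> R)
    x : open U -> U x ->
  (forall i y, U y -> is_derive y (e_ i) f (df i y)) ->
  (forall i, is_derive x (e_ i) (df i) (ddf i)) ->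
  laplacian f x = \sum_(i < n) ddf i.
Proof.
move=> oU Ux fdf dfdd; apply: eq_bigr => i _.
have dfE y : U y -> df i y = partial i f y by move=> Uy; have [_ <-] := fdf i y Uy.
by have [_ <-] := is_derive_ext_on oU dfE Ux (dfdd i).
Qed.

Lemma C2_on_is_derive2 U f i x : C2_on U f -> U x ->
  is_derive x (e_ i) (partial i f) (partial i (partial i f) x).
Proof. by move=> [_ f2] Ux; apply: C1_on_is_derive Ux; exact: f2. Qed.

Lemma laplacianD U f g x : open U -> U x -> C2_on U f -> C2_on U g ->
  laplacian (fun y => f y + g y) x = laplacian f x + laplacian g x.
Proof.
move=> oU Ux Cf Cg; rewrite /laplacian -big_split /=.
apply: (@laplacian_is_derive U _ (fun i y => partial i f y + partial i g y) _ _
  oU Ux).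
- move=> i y Uy.
  exact: is_deriveD (C1_on_is_derive i Cf.1 Uy) (C1_on_is_derive i Cg.1 Uy).
- move=> i.
  exact: is_deriveD (C2_on_is_derive2 i Cf Ux) (C2_on_is_derive2 i Cg Ux).
Qed.

Lemma laplacianZ U (c : R) f x : open U -> U x -> C2_on U f ->
  laplacian (fun y => c * f y) x = c * laplacian f x.
Proof.
move=> oU Ux Cf; rewrite /laplacian mulr_sumr.
apply: (@laplacian_is_derive U _ (fun i y => c * partial i f y) _ _ oU Ux).
- by move=> i y Uy; exact: is_deriveZ (C1_on_is_derive i Cf.1 Uy).
- by move=> i; exact: is_deriveZ (C2_on_is_derive2 i Cf Ux).
Qed.

Lemma laplacian_cst (c : R) x : laplacian (cst c : 'rV[R]_n -> R) x = 0.
Proof.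
rewrite (@laplacian_is_derive setT _ (fun _ _ => 0) (fun=> 0)) ?big1 //.
  exact: openT.
Qed.

Lemma laplacian_sum (I : eqType) (r : seq I) U (F : I -> 'rV[R]_n -> R) x :
  open U -> U x -> (forall j, j \in r -> C2_on U (F j)) ->
  laplacian (fun y => \sum_(j <- r) F j y) x = \sum_(j <- r) laplacian (F j) x.
Proof.
move=> oU Ux; elim: r => [|j r IH] CF.
  by under eq_fun do rewrite big_nil; rewrite big_nil laplacian_cst.
have CFr k : k \in r -> C2_on U (F k) by move=> kr; apply: CF; rewrite inE kr orbT.
under eq_fun do rewrite big_cons.
by rewrite big_cons -IH// (laplacianD oU Ux (CF j (mem_head j r))
  (C2_on_sum oU CFr)).
Qed.

Lemma laplacian_comp U f (P : set R) (phi dphi ddphi : R -> R) x : open U ->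
  U x -> C2_on U f -> (forall x, U x -> P (f x)) ->
  (forall t, P t -> is_derive t 1 phi (dphi t)) ->
  (forall t, P t -> is_derive t 1 dphi (ddphi t)) ->
  laplacian (fun y => phi (f y)) x =
  ddphi (f x) * (\sum_(i < n) partial i f x ^+ 2) + dphi (f x) * laplacian f x.
Proof.
move=> oU Ux Cf UP d1 d2; have [f1 f2] := Cf.
rewrite /laplacian !mulr_sumr -big_split /=.
apply: (@laplacian_is_derive U _ (fun i y => dphi (f y) * partial i f y) _ _
  oU Ux).
- move=> i y Uy; apply: is_derive_comp1 (C1_on_is_derive i f1 Uy) _.
  exact/d1/UP.
- move=> i.
  have h1 : is_derive x (e_ i) (fun y => dphi (f y))
      (ddphi (f x) * partial i f x).
    exact: is_derive_comp1 (C1_on_is_derive i f1 Ux) (d2 _ (UP _ Ux)).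
  apply: is_derive_eq (is_deriveM h1 (C2_on_is_derive2 i Cf Ux)) _.
  by rewrite /GRing.scale /= addrC expr2; ring.
Qed.

End C2_calculus.

(** * Squared Euclidean distance and radial functions *)

(** The squared Euclidean distance to [a]: unlike the distance itself it is
smooth everywhere, so radial functions are written as functions of it. *)
Definition sqdist (R : realType) (n : nat) (a x : 'rV[R]_n) : R :=
  \sum_(i < n) (x ord0 i - a ord0 i) ^+ 2.

Section Sqdist.
Context {R : realType} {n : nat}.
Implicit Types (a x v : 'rV[R]_n) (i : 'I_n).

Local Notation e_ i := (delta_mx ord0 i : 'rV[R]_n).

Lemma is_derive_coord x v i :
  is_derive x v (fun y : 'rV[R]_n => y ord0 i) (v ord0 i).
Proof.
apply/is_derive_lineP.
have -> : (fun h : R => (h *: v + x) ord0 i) =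
          (fun h : R => h * v ord0 i + x ord0 i).
  by apply/funext => h; rewrite !mxE.
apply: is_derive_eq; rewrite /GRing.scale /=; ring.
Qed.

Lemma is_derive_coordB a x v i :
  is_derive x v (fun y : 'rV[R]_n => y ord0 i - a ord0 i) (v ord0 i).
Proof.
apply: is_derive_eq (is_deriveB (is_derive_coord x v i)
  (is_derive_cst (a ord0 i) x v)) _.
by rewrite subr0.
Qed.

Lemma sqdist_ge0 a x : 0 <= sqdist a x.
Proof. by apply: sumr_ge0 => i _; exact: sqr_ge0. Qed.

Lemma sqdist_eq0 a x : (sqdist a x == 0) = (x == a).
Proof.
apply/eqP/eqP => [q0|->]; last by rewrite /sqdist big1// => i _; rewrite subrr expr0n.
apply/rowP => i; apply/eqP; rewrite -subr_eq0 -sqrf_eq0.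
by have /eqP := q0; rewrite psumr_eq0 => [/allP/(_ i (mem_index_enum _))//|j _];
  exact: sqr_ge0.
Qed.

Lemma sqdist_gt0 a x : x != a -> 0 < sqdist a x.
Proof. by move=> xa; rewrite lt_def sqdist_ge0 sqdist_eq0 xa. Qed.

Lemma eucl_normE a x : eucl_norm (x - a) = Num.sqrt (sqdist a x).
Proof. by congr Num.sqrt; apply: eq_bigr => i _; rewrite !mxE. Qed.

Lemma normr_le_sqdist a x (r : R) : 0 <= r -> sqdist a x <= r ^+ 2 ->
  `|x - a| <= r.
Proof.
move=> r0 qr; rewrite [leLHS]mx_normrE; apply/bigmax_leP; split => //= -[i j] _ /=.
rewrite (ord1 i) !mxE -(ler_pXn2r (n := 2)) ?nnegrE// real_normK ?num_real//.
apply: le_trans qr; rewrite /sqdist (bigD1 j)//= lerDl.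
by apply: sumr_ge0 => k _; exact: sqr_ge0.
Qed.

Lemma coord_cts i x : {for x, continuous (fun y : 'rV[R]_n => y ord0 i)}.
Proof. exact: coord_continuous. Qed.

Lemma is_derive_sqdist a x i :
  is_derive x (e_ i) (sqdist a) (2 * (x ord0 i - a ord0 i)).
Proof.
have -> : sqdist a =
    \sum_(j < n) (fun y : 'rV[R]_n => (y ord0 j - a ord0 j) ^+ 2).
  by apply/funext => y; rewrite fct_sumE.
have D j : is_derive x (e_ i)
    (fun y : 'rV[R]_n => (y ord0 j - a ord0 j) ^+ 2)
    ((2 * (x ord0 j - a ord0 j)) * (j == i)%:R).
  apply: is_derive_eq (is_deriveX 2 (is_derive_coordB a x (e_ i) j)) _.
  by rewrite mxE eqxx.
apply: is_derive_eq (is_derive_sum D) _.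
rewrite (bigD1 i)//= eqxx mulr1 big1 ?addr0// => j /negbTE ->.
by rewrite mulr0.
Qed.

Lemma C2_on_sqdist a : C2_on setT (sqdist a).
Proof.
have cB (c : R) i : C0_on setT (fun y : 'rV[R]_n => c * (y ord0 i - a ord0 i)).
  move=> x _; apply: continuousM; first exact: cst_continuous.
  by apply: continuousB; [exact: coord_cts|exact: cst_continuous].
apply: (@C2_on_intro _ _ _ _ (fun i x => 2 * (x ord0 i - a ord0 i))).
- exact: openT.
- apply: C0_on_sum => i.
  have c1 := cB 1 i; under eq_fun do rewrite -[_ - _]mul1r expr2.
  exact: (C0_onM c1 c1).
- by move=> i x _; exact: is_derive_sqdist.
- move=> i; apply: (@C1_on_intro _ _ _ _ (fun j _ => 2 * (e_ j) ord0 i)).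
  + exact: openT.
  + exact: cB.
  + by move=> j x _; exact: is_deriveZ (is_derive_coordB a x (e_ j) i).
  + by move=> j x _; exact: cst_continuous.
Qed.

Lemma sqdist_cts a x : {for x, continuous (sqdist a)}.
Proof. by have [[c _] _] := C2_on_sqdist a; exact: c. Qed.

Lemma laplacian_sqdist a x : laplacian (sqdist a) x = 2 * n%:R.
Proof.
have D i : is_derive x (e_ i) (fun y => 2 * (y ord0 i - a ord0 i)) 2.
  apply: is_derive_eq (is_deriveZ 2 (is_derive_coordB a x (e_ i) i)) _.
  by rewrite mxE !eqxx /GRing.scale /= mulr1.
have -> := @laplacian_is_derive _ _ setT _ _ _ x openT I
  (fun i y _ => is_derive_sqdist a y i) D.
by rewrite sumr_const card_ord mulr_natr.
Qed.

Lemma open_punctured a : open [set x : 'rV[R]_n | x != a].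
Proof.
have -> : [set x : 'rV[R]_n | x != a] = ~` [set a].
  by apply/seteqP; split=> x /= /eqP.
by apply: closed_openC; exact: accessible_closed_set1
  (hausdorff_accessible (@norm_hausdorff _ _)) _.
Qed.

Section Radial.
Variables (a : 'rV[R]_n) (phi dphi ddphi : R -> R).
Hypothesis d1 : forall t : R, 0 < t -> is_derive t 1 phi (dphi t).
Hypothesis d2 : forall t : R, 0 < t -> is_derive t 1 dphi (ddphi t).

Lemma C2_on_radial : (forall t : R, 0 < t -> {for t, continuous ddphi}) ->
  C2_on [set x | x != a] (fun x => phi (sqdist a x)).
Proof.
move=> c2; have sT : [set x | x != a] `<=` setT by [].
have qP y : y != a -> [set t | 0 < t] (sqdist a y) by move=> /sqdist_gt0.
exact: (C2_on_comp (@open_punctured a) (C2_onW sT (C2_on_sqdist a)) qP d1 d2 c2).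
Qed.

Lemma laplacian_radial x : x != a ->
  laplacian (fun x => phi (sqdist a x)) x =
  4 * sqdist a x * ddphi (sqdist a x) + 2 * n%:R * dphi (sqdist a x).
Proof.
move=> xa; have sT : [set x | x != a] `<=` setT by [].
have qP y : y != a -> [set t | 0 < t] (sqdist a y) by move=> /sqdist_gt0.
have -> := laplacian_comp (@open_punctured a) xa (C2_onW sT (C2_on_sqdist a)) qP d1 d2.
rewrite laplacian_sqdist.
have -> : \sum_(i < n) partial i (sqdist a) x ^+ 2 = 4 * sqdist a x.
  rewrite mulr_sumr; apply: eq_bigr => i _.
  by rewrite /partial; have [_ ->] := is_derive_sqdist a x i; ring.
ring.
Qed.

End Radial.

(** The library topology comes from the sup norm; the next two lemmas compare it
with [sqdist]. *)
Lemma compact_sqdist_le a (r : R) (E : set 'rV[R]_n) : closed E ->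
  (forall x, E x -> sqdist a x <= r) -> compact E.
Proof.
move=> cE Er; apply: bounded_closed_compact => //.
exists (`|a| + (1 + `|r|)); split; first by rewrite num_real.
move=> M /ltW aM x Ex /=; apply: le_trans aM.
rewrite -[x](subrK a) addrC (le_trans (ler_normD _ _))// lerD2l.
apply: normr_le_sqdist; first by rewrite addr_ge0.
apply: le_trans (Er _ Ex) _; apply: le_trans (ler_norm r) _.
rewrite sqrrD expr1n mul1r -addrA -[leLHS]addr0 addrCA.
have := sqr_ge0 `|r|; have := normr_ge0 r; lra.
Qed.

Lemma nbhs_sqdist a (V : set 'rV[R]_n) : nbhs a V ->
  exists2 r : R, 0 < r & forall x, sqdist a x < r -> V x.
Proof.
move=> /nbhs_ballP[e /= e0 eV]; exists ((e / 2) ^+ 2); first by rewrite exprn_gt0 ?divr_gt0.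
move=> x /ltW qx; apply: eV; rewrite -ball_normE /= distrC.
apply: le_lt_trans (normr_le_sqdist _ qx) _; lra.
Qed.

End Sqdist.

(** * Maximum principle *)

Section Comparison.
Context {R : realType}.

(** Second derivative test at a local minimum.  Only the existence of the second
derivative at the minimum is needed. *)
Lemma derive2_at_min (g dg : R -> R) (d e : R) : 0 < e ->
  (forall t : R, `|t| < e -> is_derive t 1 g (dg t)) -> is_derive (0 : R) 1 dg d ->
  (forall t : R, `|t| < e -> g 0 <= g t) -> 0 <= d.
Proof.
move=> e0 gdg dgd gmin.
have itvE t : t \in `]-e, e[%R -> `|t| < e by rewrite in_itv /= ltr_norml.
have dg0 : dg 0 = 0.
  have h0 : is_derive (0 : R) 1 g 0.
    apply: (@derive1_at_min _ g (-e) e 0).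
    - lra.
    - by move=> t /itvE/gdg[].
    - by rewrite in_itv /= e0 oppr_lt0 e0.
    - by move=> t /itvE/gmin.
  have [_ <-] := gdg 0 ltac:(by rewrite normr0).
  by have [_ ->] := h0.
rewrite leNgt; apply/negP => d0.
have [cdg dgE] := dgd.
have : (fun h : R => h^-1 *: ((dg \o shift 0) (h *: 1) - dg 0)) @ 0^' --> d.
  by rewrite -dgE; exact: cdg.
move=> /cvgr_lt/(_ 0 d0).
rewrite /dnbhs /within /= => /nbhs_ballP[r /= r0 rh].
pose t := Num.min e r / 2.
have m0 : 0 < Num.min e r by rewrite lt_min e0 r0.
have t0 : 0 < t by rewrite /t; lra.
have me : Num.min e r <= e by rewrite ge_min lexx.
have mr : Num.min e r <= r by rewrite ge_min lexx orbT.
have te : t < e by rewrite /t; lra.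
have tr : t < r by rewrite /t; lra.
(* If the second derivative were negative, dg would be negative just to the
   right of 0, and the mean value theorem would contradict minimality. *)
have [||c cI] := @MVT R g dg 0 t t0.
- move=> y; rewrite in_itv /= => /andP[y0 yt].
  by apply: gdg; rewrite gtr0_norm//; lra.
- apply: derivable_within_continuous => y; rewrite in_itv /= => /andP[y0 yt].
  have /gdg[] // : `|y| < e by rewrite ger0_norm//; lra.
move: cI; rewrite in_itv /= => /andP[c0 ct] gE.
have : c^-1 *: (dg (c *: 1 + 0) - dg 0) < 0.
  apply: rh; last by rewrite gt_eqF.
  by rewrite /ball /= sub0r normrN gtr0_norm//; lra.
rewrite dg0 subr0 addr0 /GRing.scale /= mulr1 pmulr_rlt0 ?invr_gt0// => dgc.
have : g 0 <= g t by apply: gmin; rewrite gtr0_norm.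
by rewrite -subr_ge0 gE subr0 pmulr_lge0// leNgt dgc.
Qed.

Context {n : nat}.
Implicit Types (U E : set 'rV[R]_n) (u w f : 'rV[R]_n -> R).
Local Notation e_ i := (delta_mx ord0 i : 'rV[R]_n).

Lemma is_derive_line f (x v : 'rV[R]_n) (t d : R) :
  is_derive (t *: v + x) v f d -> is_derive t 1 (fun s : R => f (s *: v + x)) d.
Proof.
move=> /is_derive_lineP H.
have H' : is_derive ((fun s : R => s - t) t) 1
    (fun h : R => f (h *: v + (t *: v + x))) d by rewrite subrr.
have S : is_derive t 1 (fun s : R => s - t) (1 : R).
  by apply: is_derive_eq (is_deriveB (is_derive_id t 1) (is_derive_cst t t 1)) _;
    rewrite subr0.
have := @is_derive1_comp R (fun h : R => f (h *: v + (t *: v + x)))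
  (fun s => s - t) t _ _ H' S; rewrite mulr1.
congr (is_derive _ _ _ _); apply/funext => s /=.
by rewrite addrA -scalerDl subrK.
Qed.

Lemma laplacian_ge0_at_min U f x : open U -> U x -> C2_on U f ->
  (forall y, U y -> f x <= f y) -> 0 <= laplacian f x.
Proof.
move=> oU Ux Cf fmin; apply: sumr_ge0 => i _.
have cl : {for 0, continuous (fun t : R => t *: e_ i + x)}.
  apply: continuousD; last exact: cst_continuous.
  exact: scalel_continuous.
have : nbhs ((fun t : R => t *: e_ i + x) 0) U.
  by rewrite /= scale0r add0r; exact: open_nbhs_nbhs.
move=> /cl /nbhs_ballP[e /= e0 eU].
have lU t : `|t| < e -> U (t *: e_ i + x).
  by move=> te; apply: eU; rewrite /ball /= sub0r normrN.
apply: (@derive2_at_min (fun t : R => f (t *: e_ i + x))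
  (fun t => partial i f (t *: e_ i + x)) _ e e0).
- by move=> t /lU Ut; apply: is_derive_line; exact: C1_on_is_derive Cf.1 Ut.
- by apply: is_derive_line; rewrite scale0r add0r; exact: C2_on_is_derive2 Cf Ux.
- by move=> t /lU Ut; rewrite scale0r add0r; exact: fmin.
Qed.

(** Comparison principle.  The last two hypotheses are only required where
[w > 0], that is, where a negative minimum of [u - w] can occur; in particular
[w <= 0] outside the interior of [E] plays the part of the boundary
condition. *)
Lemma comparison U E u w : open U -> compact E -> E `<=` U ->
  C2_on U u -> C2_on U w -> (forall x, E x -> 0 < u x) ->
  (forall x, E x -> 0 < w x -> E^° x) ->
  (forall x, E x -> 0 < w x -> u x < w x -> - laplacian w x < - laplacian u x) ->
  forall x, E x -> w x <= u x.
Proof.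
move=> oU cE EU Cu Cw u0 wE Lwu x1 Ex1.
have CN := C2_onZ (-1) oU Cw; have Cf := C2_onD oU Cu CN.
set f := fun y => u y + -1 * w y in Cf.
have cf : {within E, continuous f}.
  by apply: continuous_in_subspaceT => y /set_mem/EU Uy; exact: Cf.1.1.
have [x0 /set_mem Ex0 fmin] := compact_EVT_min (ex_intro _ _ Ex1) cE cf.
suff fx0 : 0 <= f x0.
  by have := le_trans fx0 (fmin x1 (mem_set Ex1)); rewrite /f; lra.
rewrite leNgt; apply/negP => fx0.
have uw : u x0 < w x0 by move: fx0; rewrite /f; lra.
have w0 : 0 < w x0 by apply: lt_trans uw; exact: u0.
have Ux0 := EU _ Ex0.
have oI : open E^° by exact: open_interior.
have Ix0 := wE _ Ex0 w0.
have IU : E^° `<=` U by apply: subset_trans EU; exact: interior_subset.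
have := laplacian_ge0_at_min oI Ix0 (C2_onW IU Cf).
have -> : laplacian f x0 = laplacian u x0 + -1 * laplacian w x0.
  by rewrite -(laplacianZ (-1) oU Ux0 Cw) -(laplacianD oU Ux0 Cu CN).
have := Lwu _ Ex0 w0 uw.
move=> h H; have : 0 <= laplacian u x0 + -1 * laplacian w x0.
  by apply: H => y /interior_subset/mem_set; exact: fmin.
by rewrite mulN1r subr_ge0 leNgt -ltrN2 h.
Qed.

End Comparison.

(** * Powers, distance to the boundary and elementary topology *)

Section Powers.
Context {R : realType}.
Implicit Types (a b r s : R).

Lemma le0_ler_powR r a b : r <= 0 -> 0 < a -> a <= b -> b `^ r <= a `^ r.
Proof.
move=> r0 a0 ab; have b0 := lt_le_trans a0 ab.
rewrite -[r]opprK powRN [leRHS]powRN lef_pV2 ?posrE ?powR_gt0//.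
by apply: ge0_ler_powR; rewrite ?nnegrE ?oppr_ge0// ltW.
Qed.

Lemma lt0_ltr_powR r a b : r < 0 -> 0 < a -> a < b -> b `^ r < a `^ r.
Proof.
move=> r0 a0 ab; have b0 := lt_trans a0 ab.
rewrite -[r]opprK powRN [ltRHS]powRN ltf_pV2 ?posrE ?powR_gt0//.
by apply: gt0_ltr_powR; rewrite ?nnegrE ?oppr_gt0// ltW.
Qed.

Lemma lt0_ltr_ln a b : 0 < a -> a < b -> ln a < ln b.
Proof.
move=> a0 ab; have b0 := lt_trans a0 ab.
rewrite ltr_ln; [exact: ab|exact: a0|exact: b0].
Qed.

Lemma lt0_ler_ln a b : 0 < a -> a <= b -> ln a <= ln b.
Proof.
move=> a0 ab; have b0 := lt_le_trans a0 ab.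
rewrite ler_ln; [exact: ab|exact: a0|exact: b0].
Qed.

Lemma powR_sqrt a r : 0 <= a -> Num.sqrt a `^ r = a `^ (r / 2).
Proof. by move=> a0; rewrite -powR12_sqrt// -powRrM mulrC. Qed.

(** A single small parameter meeting two smallness conditions; it is used to
choose the coefficient of the logarithmic correction in the barriers. *)
Lemma exists_small (X Y c d : R) : 0 < c -> 0 < d -> 0 <= X -> 0 <= Y ->
  exists2 k, 0 < k & k * X < c /\ k * Y < d.
Proof.
move=> c0 d0 X0 Y0.
have X1 : 0 < X + 1 by lra.
have Y1 : 0 < Y + 1 by lra.
have cX : 0 < c / (X + 1) by rewrite divr_gt0.
have dY : 0 < d / (Y + 1) by rewrite divr_gt0.
pose k := Num.min (c / (X + 1)) (d / (Y + 1)).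
have k0 : 0 < k by rewrite lt_min cX dY.
exists k => //; split.
  have : k <= c / (X + 1) by rewrite ge_min lexx.
  rewrite ler_pdivlMr// mulrDr mulr1; lra.
have : k <= d / (Y + 1) by rewrite ge_min lexx orbT.
rewrite ler_pdivlMr// mulrDr mulr1; lra.
Qed.

End Powers.

Section Distance.
Context {R : realType} {n : nat}.
Implicit Types (a x y : 'rV[R]_n) (K : set 'rV[R]_n).

Lemma sqdistC a x : sqdist a x = sqdist x a.
Proof. by apply: eq_bigr => i _; rewrite -sqrrN opprB. Qed.

Lemma boundary_sub K : closed K -> boundary K `<=` K.
Proof. by move=> cK x [+ _]; rewrite -(closure_id K).1. Qed.

Lemma delta_le K a x : boundary K a -> delta K x <= Num.sqrt (sqdist a x).
Proof.
move=> Ka; rewrite /delta /dist_to -eucl_normE; apply: ge_inf; last by exists a.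
by exists 0 => _ [y _ <-]; exact: sqrtr_ge0.
Qed.

Lemma delta_gt0 K a x : closed K -> boundary K a -> ~ K x -> 0 < delta K x.
Proof.
move=> cK Ka Kx.
have : nbhs x (~` K) by apply: open_nbhs_nbhs; split => //; exact: closed_openC.
move=> /nbhs_sqdist[r r0 rK].
apply: (@lt_le_trans _ _ (Num.sqrt r)); first by rewrite sqrtr_gt0.
apply: lb_le_inf; first by exists (eucl_norm (x - a)), a.
move=> _ [y /(boundary_sub cK) Ky <-]; rewrite eucl_normE ler_sqrt ?sqdist_ge0//.
by rewrite leNgt; apply/negP => /[!(sqdistC y)] /rK.
Qed.

Variables (K : set 'rV[R]_n) (alpha p : R) (u : 'rV[R]_n -> R).
Hypotheses (cK : closed K) (alpha_le0 : alpha <= 0) (p_gt0 : 0 < p).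
Hypothesis solu : positive_C2_solution K alpha p u.

(** The form in which the differential inequality is used: upper bounds on the
distance and on [u] give a lower bound on [- laplacian u], because both
exponents [alpha] and [- p] are negative. *)
Lemma solution_ge_delta a x (r M : R) : boundary K a -> ~ K x ->
  delta K x <= r -> u x <= M -> r `^ alpha * M `^ (- p) <= - laplacian u x.
Proof.
move=> Ka Kx dr uM; have [_ u0 Lu] := solu.
apply: le_trans (Lu _ Kx); apply: ler_pM; rewrite ?powR_ge0//.
  by apply: le0_ler_powR => //; exact: delta_gt0 Ka Kx.
by apply: le0_ler_powR (u0 _ Kx) uM; rewrite oppr_le0 ltW.
Qed.

Lemma solution_ge_sqdist a x (M : R) : boundary K a -> ~ K x -> u x <= M ->
  sqdist a x `^ (alpha / 2) * M `^ (- p) <= - laplacian u x.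
Proof.
move=> Ka Kx uM; rewrite -powR_sqrt ?sqdist_ge0//.
exact: solution_ge_delta Ka Kx (delta_le _ Ka) uM.
Qed.

End Distance.

Section Topology.
Context {R : realType} {n : nat}.
Implicit Types (a x y : 'rV[R]_n) (K : set 'rV[R]_n) (i : 'I_n).
Local Notation e_ i := (delta_mx ord0 i : 'rV[R]_n).

Lemma sqdist_line a i (t : R) : sqdist a (a + t *: e_ i) = t ^+ 2.
Proof.
rewrite /sqdist (bigD1 i)//= !mxE !eqxx mulr1 [_ + t]addrC addrK big1 ?addr0// => j ji.
by rewrite !mxE (negbTE ji) mulr0 addr0 subrr expr0n.
Qed.

(** A point of [K] with maximal first coordinate is a boundary point. *)
Lemma boundary_nonempty K : (0 < n)%N -> compact K -> K !=set0 ->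
  boundary K !=set0.
Proof.
move=> n0 cK K0; pose i := Ordinal n0.
have cf : {within K, continuous (fun x : 'rV[R]_n => x ord0 i)}.
  by apply: continuous_in_subspaceT => y _; exact: coord_cts.
have [z /set_mem Kz zmax] := compact_EVT_max K0 cK cf.
exists z; split; first exact: subset_closure.
move=> /nbhs_sqdist[r r0 rK].
pose t := Num.sqrt r / 2; have s0 : 0 < Num.sqrt r by rewrite sqrtr_gt0.
have t0 : 0 < t by rewrite /t; lra.
have /mem_set/zmax : K (z + t *: e_ i).
  apply: rK; rewrite sqdist_line -[ltRHS]sqr_sqrtr ?ltW// ltr_pXn2r ?nnegrE ?ltW//.
  by rewrite /t; lra.
by rewrite !mxE !eqxx mulr1; lra.
Qed.

Lemma isolated_sqdist K a : isolated K a ->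
  exists2 r : R, 0 < r & forall x, x != a -> sqdist a x < r -> ~ K x.
Proof.
move=> [_ [V /nbhs_sqdist[r r0 rV] VK]]; exists r => // x xa xr Kx.
have : (V `&` K) x by split => //; exact: rV.
by rewrite VK => /eqP; apply/negP.
Qed.

Lemma isolated_boundary K a : (0 < n)%N -> isolated K a -> boundary K a.
Proof.
move=> n0 Ka; have [r r0 rK] := isolated_sqdist Ka.
split; first by apply: subset_closure; exact: isolatedS.
move=> /nbhs_sqdist[r' r'0 r'K].
pose i := Ordinal n0; pose q := Num.min r r'.
have q0 : 0 < q by rewrite lt_min r0 r'0.
pose t := Num.sqrt q / 2; have s0 : 0 < Num.sqrt q by rewrite sqrtr_gt0.
have t0 : 0 < t by rewrite /t; lra.
have : sqdist a (a + t *: e_ i) < q.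
  rewrite sqdist_line -[ltRHS]sqr_sqrtr ?ltW// ltr_pXn2r ?nnegrE ?ltW//.
  by rewrite /t; lra.
rewrite lt_min => /andP[tr /r'K]; apply: rK tr.
by rewrite -sqdist_eq0 sqdist_line sqrf_eq0 gt_eqF.
Qed.

Lemma compact_isolated_finite K : compact K -> K = isolated K -> finite_set K.
Proof.
rewrite compact_cover => cK KI.
have : forall x, exists V, open V /\ (K x -> V x /\ V `&` K `<=` [set x]).
  move=> x; have [Kx|] := pselect (K x); last by exists setT; split => //; exact: openT.
  have : isolated K x by rewrite -KI.
  move=> -[_ [V Vx VK]]; exists V^°; split.
    exact: open_interior.
  move=> _; split => // y [/interior_subset Vy Ky].
  have : (V `&` K) y by split.
  by rewrite VK.
move=> /choice[V VP].
have [||D DK KD] := cK _ K V.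
- by move=> x _; have [] := VP x.
- by move=> x Kx; exists x => //; have [_ /(_ Kx)[]] := VP x.
apply: sub_finite_set (finite_fset D) => x Kx.
have [y /= yD Vyx] := KD _ Kx.
have Ky : K y by have := DK _ yD; rewrite inE.
have [_ /(_ Ky)[_ /(_ x)]] := VP y.
by move=> -> //.
Qed.

End Topology.

(** * Radial barriers *)

(** The functions [(b0 + b1 ln t) t^e] form a family closed under derivation
which contains powers, the logarithm and their products. *)
Definition logpow (R : realType) (b0 b1 e t : R) : R :=
  (b0 + b1 * ln t) * t `^ e.

Section Logpow.
Context {R : realType}.
Implicit Types (b e t : R).

Lemma powR_subr1 t e : 0 < t -> t `^ (e - 1) = t `^ e / t.
Proof. by move=> t0; rewrite powRB ?powRr1 ?ltW ?(gt_eqF t0) ?implybT. Qed.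

Lemma is_derive_logpow b0 b1 e t : 0 < t ->
  is_derive t 1 (logpow b0 b1 e) (logpow (b1 + e * b0) (e * b1) (e - 1) t).
Proof.
move=> t0.
have D1 : is_derive t 1 (fun t => b0 + b1 * ln t) (b1 * t^-1).
  apply: is_derive_eq (is_deriveD (is_derive_cst b0 t 1)
    (is_deriveZ b1 (is_derive1_ln t0))) _.
  by rewrite add0r.
apply: is_derive_eq (is_deriveM D1 (is_derive1_powR e t0)) _.
rewrite /logpow /GRing.scale /= powR_subr1//; ring.
Qed.

Variable n : nat.
Implicit Types (a x : 'rV[R]_n).

Lemma C2_on_logpow a b0 b1 e :
  C2_on [set x | x != a] (fun x => logpow b0 b1 e (sqdist a x)).
Proof.
apply: (@C2_on_radial R n a _ _ _ (is_derive_logpow b0 b1 e)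
  (is_derive_logpow _ _ _)) => t t0.
have [D _] := is_derive_logpow (e * b1 + (e - 1) * (b1 + e * b0))
  ((e - 1) * (e * b1)) (e - 1 - 1) t0.
exact/differentiable_continuous/derivable1_diffP.
Qed.

Lemma laplacian_logpow a b0 b1 e x : x != a ->
  laplacian (fun x => logpow b0 b1 e (sqdist a x)) x =
  (2 * e * (2 * e - 2 + n%:R) * (b0 + b1 * ln (sqdist a x)) +
   (8 * e - 4 + 2 * n%:R) * b1) * sqdist a x `^ (e - 1).
Proof.
move=> xa; have q0 := sqdist_gt0 xa.
rewrite (@laplacian_radial R n a _ _ _ (is_derive_logpow b0 b1 e)
  (is_derive_logpow _ _ _))//.
rewrite /logpow [_ `^ (e - 1 - 1)]powR_subr1//.
by field; rewrite gt_eqF.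
Qed.

(** The radial barriers: [b0 + b1 ln q + (c0 + c1 ln q) q^(1 - n/2)], where
[q^(1 - n/2) = |x - a|^(2 - n)] is harmonic.  Hence only [b1] and [c1]
contribute to the Laplacian, see [laplacian_barrier]. *)
Definition barrier a (b0 b1 c0 c1 : R) x : R :=
  logpow b0 b1 0 (sqdist a x) + logpow c0 c1 (- (n%:R / 2 - 1)) (sqdist a x).

Lemma C2_on_barrier a b0 b1 c0 c1 U : open U -> U `<=` [set x | x != a] ->
  C2_on U (barrier a b0 b1 c0 c1).
Proof.
move=> oU Ua; apply: (C2_onW Ua).
exact: (C2_onD (@open_punctured R n a) (C2_on_logpow a b0 b1 0)
  (C2_on_logpow _ _ _ _)).
Qed.

Lemma laplacian_barrier a b0 b1 c0 c1 x : x != a ->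
  - laplacian (barrier a b0 b1 c0 c1) x = 2 * (n%:R - 2) *
    (c1 * sqdist a x `^ (- (n%:R / 2)) - b1 * sqdist a x `^ (- 1)).
Proof.
move=> xa; rewrite (laplacianD (@open_punctured R n a) xa (C2_on_logpow a b0 b1 0)
  (C2_on_logpow _ _ _ _)).
rewrite !laplacian_logpow//.
have -> : - (n%:R / 2 - 1) - 1 = - (n%:R / 2) :> R by ring.
by rewrite sub0r; field.
Qed.

Lemma barrierE a b0 b1 c0 c1 x : barrier a b0 b1 c0 c1 x =
  b0 + b1 * ln (sqdist a x) +
  (c0 + c1 * ln (sqdist a x)) * sqdist a x `^ (- (n%:R / 2 - 1)).
Proof. by rewrite /barrier /logpow powRr0 mulr1. Qed.

Lemma exists_sqdist a (q : R) : (0 < n)%N -> 0 <= q -> exists x, sqdist a x = q.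
Proof.
move=> n0 q0; exists (a + Num.sqrt q *: delta_mx ord0 (Ordinal n0)).
by rewrite sqdist_line sqr_sqrtr.
Qed.

Lemma closed_sqdist_ge a (c : R) : closed [set x | c <= sqdist a x].
Proof.
apply: (@closed_comp _ _ (sqdist a) [set t | c <= t]); last exact: closed_ge.
by move=> x _; exact: sqdist_cts.
Qed.

Lemma closed_sqdist_le a (c : R) : closed [set x | sqdist a x <= c].
Proof.
apply: (@closed_comp _ _ (sqdist a) [set t | t <= c]); last exact: closed_le.
by move=> x _; exact: sqdist_cts.
Qed.

Lemma annulus_interior a (c d : R) x : c < sqdist a x < d ->
  ([set x | c <= sqdist a x] `&` [set x | sqdist a x <= d])^° x.
Proof.
move=> /andP[cx xd].
have : nbhs (sqdist a x) `]c, d[%classic.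
  by apply: open_nbhs_nbhs; split; [exact: interval_open|rewrite /= in_itv /= cx xd].
move=> /(@sqdist_cts _ _ a x) H; apply: (@filterS _ (nbhs x) _ _ _ _ H) => y /=.
by rewrite in_itv /= => /andP[/ltW ? /ltW].
Qed.

Lemma annulus_compact a (c d : R) :
  compact ([set x | c <= sqdist a x] `&` [set x | sqdist a x <= d]).
Proof.
apply: (@compact_sqdist_le _ _ a d); last by move=> x [].
by apply: closedI; [exact: closed_sqdist_ge|exact: closed_sqdist_le].
Qed.

(** The comparison principle for radial barriers on a closed annulus. *)
Lemma comparison_annulus a (K : set 'rV[R]_n) (u : 'rV[R]_n -> R)
    (b0 b1 c0 c1 c d : R) : closed K -> C2_on (~` K) u -> 0 < c ->
  (forall x, c <= sqdist a x <= d -> ~ K x /\ 0 < u x) ->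
  (forall x, sqdist a x = c \/ sqdist a x = d -> barrier a b0 b1 c0 c1 x <= 0) ->
  (forall x, c <= sqdist a x <= d -> u x < barrier a b0 b1 c0 c1 x ->
     - laplacian (barrier a b0 b1 c0 c1) x < - laplacian u x) ->
  forall x, c <= sqdist a x <= d -> barrier a b0 b1 c0 c1 x <= u x.
Proof.
move=> cK Cu c_gt0 EK wbd Lwu x /andP[cx xd].
set E := [set x | c <= sqdist a x] `&` [set x | sqdist a x <= d].
have EP y : E y -> c <= sqdist a y <= d by move=> [/= -> ->].
pose U := ~` K `&` [set x | x != a].
have oU : open U by apply: openI; [exact: closed_openC|exact: open_punctured].
apply: (@comparison R n U E) => //.
- exact: annulus_compact.
- move=> y /EP cyd; split; first by have [] := EK _ cyd.
  by rewrite /= -sqdist_eq0 gt_eqF//; case/andP: cyd => /(lt_le_trans c_gt0).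
- by apply: C2_onW Cu => y [].
- by apply: C2_on_barrier => // y [].
- by move=> y /EP/EK[].
- move=> y [/= cy yd] w0; apply: annulus_interior.
  rewrite !lt_neqAle cy yd !andbT; apply/andP; split; apply/eqP => q.
    by move: w0; rewrite ltNge wbd//; left.
  by move: w0; rewrite ltNge wbd//; right.
- by move=> y /EP cyd _; exact: Lwu.
Qed.

End Logpow.

(** * Necessary conditions at infinity and at isolated points *)

Section NecessaryConditions.
Context {R : realType} {n : nat}.
Variables (K : set 'rV[R]_n) (alpha p : R) (u : 'rV[R]_n -> R) (a : 'rV[R]_n).
Hypotheses (n_gt2 : (2 < n)%N) (cK : closed K) (Ka : boundary K a).
Hypotheses (alpha_lt0 : alpha < 0) (p_gt0 : 0 < p).
Hypothesis solu : positive_C2_solution K alpha p u.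

Local Notation m := (n%:R / 2 - 1 : R).

Let n2_gt0 : 0 < n%:R - 2 :> R.
Proof. by rewrite subr_gt0 ltr_nat. Qed.

Let n22_gt0 : 0 < 2 * (n%:R - 2) :> R.
Proof. by have := n2_gt0; lra. Qed.

Let m_gt0 : 0 < m.
Proof. by have := n2_gt0; lra. Qed.

Let n_gt0 : (0 < n)%N.
Proof. by case: (n) n_gt2. Qed.

Let solu_C2 : C2_on (~` K) u.
Proof. by case: solu. Qed.

Let solu_gt0 x : ~ K x -> 0 < u x.
Proof. by case: solu => _ + _; apply. Qed.

Let solu_ge x M : ~ K x -> u x <= M ->
  sqdist a x `^ (alpha / 2) * M `^ (- p) <= - laplacian u x.
Proof. exact: (solution_ge_sqdist cK (ltW alpha_lt0) p_gt0 solu Ka). Qed.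

(** The behaviour at infinity alone forces [alpha < -2]. *)
Lemma solution_alpha_ltN2 (q0 : R) : (forall x, K x -> sqdist a x < q0) ->
  alpha < - 2.
Proof.
move=> Kq0; rewrite ltNge; apply/negP => ha.
pose q1 := Num.max q0 1.
have q1_ge1 : 1 <= q1 by rewrite le_max lexx orbT.
have q1_gt0 : 0 < q1 by apply: lt_le_trans q1_ge1.
have Kq1 x : q1 <= sqdist a x -> ~ K x.
  move=> q1x /Kq0; rewrite ltNge => /negP; apply; apply: le_trans q1x.
  by rewrite le_max lexx.
have [x qx] := @exists_sqdist R n a (4 * q1) n_gt0 ltac:(lra).
have Kx : ~ K x by apply: Kq1; rewrite qx; lra.
have ux := solu_gt0 Kx.
pose s0 := q1 `^ (- m); pose sx := (4 * q1) `^ (- m).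
have sx_gt0 : 0 < sx by apply: powR_gt0; lra.
have s0_gt0 : 0 < s0 by apply: powR_gt0; lra.
have sxs0 : 0 < s0 - sx.
  by rewrite subr_gt0; apply: lt0_ltr_powR => //; have := m_gt0; lra.
(* A is such that the harmonic part of the barrier equals 2 * u x at x. *)
pose A := 2 * u x / (s0 - sx).
have A_gt0 : 0 < A by rewrite divr_gt0// mulr_gt0.
have AE : A * (s0 - sx) = 2 * u x by rewrite divfK// gt_eqF.
have M_gt0 : 0 < (A * s0) `^ (- p) by rewrite powR_gt0// mulr_gt0.
have q14 : q1 < 4 * q1 by lra.
have q14_gt0 : 0 < 4 * q1 by lra.
have l4 : 0 < ln (4 * q1) - ln q1 by rewrite subr_gt0; exact: lt0_ltr_ln.
have X0 : 0 <= A * (ln (4 * q1) - ln q1) by rewrite mulr_ge0 ?ltW.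
have Y0 : 0 <= A * (2 * (n%:R - 2)) by exact/ltW/(mulr_gt0 A_gt0 n22_gt0).
have [k k_gt0 [kX kY]] := exists_small ux M_gt0 X0 Y0.
(* The outer radius is where the logarithm has absorbed the harmonic part. *)
pose Q := q1 * expR (s0 / k).
have Q_gt0 : 0 < Q by rewrite mulr_gt0// expR_gt0.
have lnQ : k * (ln Q - ln q1) = s0.
  rewrite lnM ?posrE ?expR_gt0// expRK addrAC subrr add0r mulrC divfK//.
  by rewrite gt_eqF.
pose w := barrier a (A * s0 + A * k * ln q1) (- (A * k)) (- A) 0.
have wE y : w y = A * (s0 - sqdist a y `^ (- m) -
                       k * (ln (sqdist a y) - ln q1)).
  by rewrite /w barrierE; ring.
have wx : u x < w x.
  rewrite wE qx -/sx mulrBr AE mulrCA; move: kX; lra.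
have wQ y : Q <= sqdist a y -> w y <= 0.
  move=> Qy; rewrite wE pmulr_rle0// -lnQ.
  have : k * (ln Q - ln q1) <= k * (ln (sqdist a y) - ln q1).
    by rewrite ler_pM2l// lerD2r; exact: lt0_ler_ln.
  have := powR_ge0 (sqdist a y) (- m); lra.
have xQ : sqdist a x <= Q.
  rewrite leNgt; apply/negP => /ltW/wQ; rewrite leNgt => /negP; apply.
  exact: lt_trans wx.
suff : w x <= u x by rewrite leNgt wx.
apply: (@comparison_annulus R n a K u _ _ _ _ q1 Q cK solu_C2 q1_gt0).
- by move=> y /andP[q1y _]; have Ky := Kq1 _ q1y; split; [|exact: solu_gt0].
- move=> y [] yq; last by apply: wQ; rewrite yq.
  by rewrite -/(w y) wE yq !subrr mulr0 subr0 mulr0.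
- move=> y /andP[q1y _] uwy; have Ky := Kq1 _ q1y.
  have qy : 0 < sqdist a y by apply: lt_le_trans q1y.
  have uM : u y <= A * s0.
    apply: (@le_trans _ _ (w y)); first exact: ltW.
    rewrite wE ler_pM2l//.
    have : 0 <= k * (ln (sqdist a y) - ln q1).
      apply: mulr_ge0; first exact: ltW.
      by rewrite subr_ge0; exact: lt0_ler_ln.
    have := powR_ge0 (sqdist a y) (- m); lra.
  apply: lt_le_trans (solu_ge Ky uM).
  rewrite laplacian_barrier; last by rewrite -sqdist_eq0 gt_eqF.
  apply: (@lt_le_trans _ _ (sqdist a y `^ (- 1) * (A * s0) `^ (- p))).
    have -> : 2 * (n%:R - 2) * (0 * sqdist a y `^ (- (n%:R / 2)) -
      - (A * k) * sqdist a y `^ (-1)) =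
      sqdist a y `^ (-1) * (k * (A * (2 * (n%:R - 2)))) by ring.
    by rewrite ltr_pM2l// powR_gt0.
  rewrite ler_pM2r//; apply: ler_powR; first exact: le_trans q1y.
  by move: ha; lra.
- by rewrite xQ qx andbT; lra.
Qed.

(** Here [a] is an isolated point of [K]: the punctured ball [0 < q < r0]
avoids [K]. *)
Section Isolated.
Variable r0 : R.
Hypotheses (r0_gt0 : 0 < r0).
Hypothesis Kr0 : forall x, x != a -> sqdist a x < r0 -> ~ K x.

Let q1 := Num.min r0 1 / 2.

Let q1_gt0 : 0 < q1.
Proof. by rewrite divr_gt0// lt_min r0_gt0 ltr01. Qed.

Let q1_lt1 : q1 < 1.
Proof.
have : Num.min r0 1 <= 1 by rewrite ge_min lexx orbT.
by rewrite /q1; lra.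
Qed.

Let q1_ltr0 : q1 < r0.
Proof.
have : Num.min r0 1 <= r0 by rewrite ge_min lexx.
by have := r0_gt0; rewrite /q1; lra.
Qed.

Let Kq1 x : 0 < sqdist a x <= q1 -> ~ K x.
Proof.
move=> /andP[x0 xq1]; apply: Kr0; last exact: le_lt_trans q1_ltr0.
by rewrite -sqdist_eq0 gt_eqF.
Qed.

(** If [N + alpha + p (N - 2) <= 0], the bound [u < w <= A q^(1 - n/2)] at a
contact point makes [- laplacian u] at least of order [q^(- n/2)], which is the
order of the Laplacian of [q^(1 - n/2) ln q]. *)
Lemma solution_exponent_gt0 : 0 < n%:R + alpha + p * (n%:R - 2).
Proof.
rewrite ltNge; apply/negP => hp.
have q12 : q1 / 2 < q1 by have := q1_gt0; lra.
have q12_gt0 : 0 < q1 / 2 by have := q1_gt0; lra.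
have [x qx] := exists_sqdist a n_gt0 (ltW q12_gt0).
have Kx : ~ K x by apply: Kq1; rewrite qx q12_gt0 ltW.
have ux := solu_gt0 Kx.
pose s0 := q1 `^ (- m); pose sx := (q1 / 2) `^ (- m).
have sx_gt0 : 0 < sx by exact: powR_gt0.
have s0_gt0 : 0 < s0 by exact: powR_gt0.
have sxs0 : 0 < sx - s0.
  by rewrite subr_gt0; apply: lt0_ltr_powR => //; have := m_gt0; lra.
pose A := 2 * u x / (sx - s0).
have A_gt0 : 0 < A by rewrite divr_gt0// mulr_gt0.
have AE : A * (sx - s0) = 2 * u x by rewrite divfK// gt_eqF.
have M_gt0 : 0 < A `^ (- p) by rewrite powR_gt0.
have lx : ln (q1 / 2) < 0.
  by apply: ln_lt0; rewrite q12_gt0 (lt_trans q12).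
have X0 : 0 <= A * sx * - ln (q1 / 2).
  by apply: mulr_ge0; [apply: mulr_ge0; exact: ltW|rewrite oppr_ge0 ltW].
have Y0 : 0 <= A * (2 * (n%:R - 2)) by exact/ltW/(mulr_gt0 A_gt0 n22_gt0).
have [k k_gt0 [kX kY]] := exists_small ux M_gt0 X0 Y0.
(* Below eps the factor 1 + k ln q of the barrier is nonpositive. *)
pose eps := expR (- k^-1).
have eps_gt0 : 0 < eps by exact: expR_gt0.
have keps : k * ln eps = - 1 by rewrite expRK mulrN divff// gt_eqF.
pose w := barrier a (- (A * s0)) 0 A (A * k).
have wE y : w y = A * (sqdist a y `^ (- m) * (1 + k * ln (sqdist a y)) - s0).
  by rewrite /w barrierE; ring.
have wx : u x < w x.
  rewrite wE qx -/sx mulrBr mulrDr mulr1 mulrDr.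
  have -> : A * (sx * (k * ln (q1 / 2))) = - (k * (A * sx * - ln (q1 / 2))).
    by ring.
  by move: AE kX; rewrite mulrBr; lra.
have weps y : 0 < sqdist a y -> sqdist a y <= eps -> w y <= 0.
  move=> y0 yeps; rewrite wE pmulr_rle0//.
  have : k * ln (sqdist a y) <= -1.
    by rewrite -keps ler_pM2l//; exact: lt0_ler_ln.
  move=> h; have : sqdist a y `^ (- m) * (1 + k * ln (sqdist a y)) <= 0.
    by rewrite pmulr_rle0 ?powR_gt0//; lra.
  by lra.
have xeps : eps <= sqdist a x.
  rewrite leNgt; apply/negP => /ltW/weps.
  rewrite qx leNgt => /(_ q12_gt0)/negP; apply.
  exact: lt_trans wx.
suff : w x <= u x by rewrite leNgt wx.
apply: (@comparison_annulus R n a K u _ _ _ _ eps q1 cK solu_C2 eps_gt0).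
- move=> y /andP[ey yq1]; have Ky : ~ K y.
    by apply: Kq1; rewrite yq1 (lt_le_trans eps_gt0).
  by split=> //; exact: solu_gt0.
- move=> y [] yq; first by apply: weps; rewrite yq.
  rewrite -/(w y) wE yq pmulr_rle0// -/s0 mulrDr mulr1 addrAC subrr add0r.
  rewrite pmulr_rle0// pmulr_rle0//; apply: ln_le0; exact: ltW.
- move=> y /andP[ey yq1] uwy.
  have y0 : 0 < sqdist a y by apply: lt_le_trans ey.
  have Ky : ~ K y by apply: Kq1; rewrite yq1 y0.
  have lny : ln (sqdist a y) <= 0.
    by apply: ln_le0; apply: le_trans yq1 _; exact: ltW.
  have uM : u y <= A * sqdist a y `^ (- m).
    apply: (@le_trans _ _ (w y)); first exact: ltW.
    rewrite wE ler_pM2l// mulrDr mulr1.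
    have : sqdist a y `^ (- m) * (k * ln (sqdist a y)) <= 0.
      by rewrite pmulr_rle0 ?powR_gt0// pmulr_rle0.
    by have := s0_gt0; lra.
  apply: lt_le_trans (solu_ge Ky uM).
  rewrite laplacian_barrier; last by rewrite -sqdist_eq0 gt_eqF.
  apply: (@lt_le_trans _ _ (sqdist a y `^ (- (n%:R / 2)) * A `^ (- p))).
    have -> : 2 * (n%:R - 2) * (A * k * sqdist a y `^ (- (n%:R / 2)) -
      0 * sqdist a y `^ (-1)) =
      sqdist a y `^ (- (n%:R / 2)) * (k * (A * (2 * (n%:R - 2)))) by ring.
    by rewrite ltr_pM2l// powR_gt0.
  rewrite powRM ?powR_ge0//; last exact: ltW.
  rewrite -powRrM mulrCA -powRD; last by rewrite (gt_eqF y0) implybT.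
  rewrite mulrC ler_pM2l//; apply: ger_powR.
    by rewrite y0 (le_trans yq1)// ltW.
  by move: hp; lra.
- by rewrite xeps qx ltW.
Qed.

(** When [alpha <= -2] no solution is bounded near an isolated point. *)
Lemma solution_unbounded (M : R) : alpha <= - 2 ->
  ~ forall x, 0 < sqdist a x < r0 -> u x <= M.
Proof.
move=> ha uM0.
have uM x : 0 < sqdist a x <= q1 -> u x <= M.
  move=> /andP[x0 xq]; apply: uM0; rewrite x0 /=; exact: le_lt_trans q1_ltr0.
have M_gt0 : 0 < M.
  have [x qx] := exists_sqdist a n_gt0 (ltW q1_gt0).
  have xq : 0 < sqdist a x <= q1 by rewrite qx q1_gt0 lexx.
  by apply: lt_le_trans (uM _ xq); exact/solu_gt0/Kq1.
have Mp_gt0 : 0 < M `^ (- p) by rewrite powR_gt0.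
(* B is small enough for the contact inequality, uniformly in k. *)
pose B := M `^ (- p) / (2 * (n%:R - 2)) / 2.
have B_gt0 : 0 < B by rewrite divr_gt0// divr_gt0.
have BE : 2 * (n%:R - 2) * B < M `^ (- p).
  have -> : 2 * (n%:R - 2) * B = M `^ (- p) / 2.
    by rewrite /B; field; rewrite gt_eqF.
  by lra.
have lnq1 r : ln (q1 * expR r) = ln q1 + r.
  by rewrite [LHS]lnM ?posrE ?expR_gt0// expRK.
(* At radius qs the logarithmic part of the barrier equals M + 1. *)
pose qs := q1 * expR (- ((M + 1) / B)).
have qs_gt0 : 0 < qs by rewrite mulr_gt0// expR_gt0.
have lnqs : ln q1 - ln qs = (M + 1) / B.
  by rewrite lnq1; ring.
have qsq1 : qs <= q1.
  rewrite -[leRHS]mulr1 ler_pM2l// -[leRHS]expR0 ler_expR oppr_le0.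
  by rewrite divr_ge0 ?ltW//; lra.
have [x qx] := exists_sqdist a n_gt0 (ltW qs_gt0).
have xq : 0 < sqdist a x <= q1 by rewrite qx qs_gt0.
pose s0 := q1 `^ (- m); pose sx := qs `^ (- m).
have s0_gt0 : 0 < s0 by exact: powR_gt0.
have sxs0 : 0 <= sx - s0.
  by rewrite subr_ge0; apply: le0_ler_powR => //; have := m_gt0; lra.
have [k k_gt0 [kX _]] := exists_small ltr01 ltr01 sxs0 ler01.
pose L := 4 * B / (k * s0 * m ^+ 2).
have D_gt0 : 0 < k * s0 * m ^+ 2.
  by rewrite mulr_gt0 ?mulr_gt0 ?exprn_gt0//; exact: m_gt0.
have L_gt0 : 0 < L by rewrite divr_gt0// mulr_gt0.
pose eps := q1 * expR (- L).
have eps_gt0 : 0 < eps by rewrite mulr_gt0// expR_gt0.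
have lneps : ln eps = ln q1 - L.
  by rewrite lnq1.
pose w := barrier a (B * ln q1 + k * s0) (- B) (- k) 0.
have wE y : w y = B * (ln q1 - ln (sqdist a y)) -
                  k * (sqdist a y `^ (- m) - s0).
  by rewrite /w barrierE; ring.
(* Near a the power q^(- m) dominates the logarithm: with l = ln (q1 / q) it is
   s0 exp (m l), and exp (m l) >= (1 + m l / 2)^2 >= 1 + (m l)^2 / 4 beats the
   linear term B l once l >= L. *)
have weps y : 0 < sqdist a y -> sqdist a y <= eps -> w y <= 0.
  move=> y0 yeps; rewrite wE.
  pose l := ln q1 - ln (sqdist a y).
  have Ll : L <= l.
    by have := lt0_ler_ln y0 yeps; rewrite lneps /l; lra.
  have l_gt0 : 0 < l by apply: lt_le_trans Ll.
  have m0 := m_gt0.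
  have -> : sqdist a y `^ (- m) = s0 * (expR (m * l / 2)) ^+ 2.
    rewrite /s0 /powR !gt_eqF// -expRM_natl -expRD; congr expR.
    by rewrite /l; field.
  have e1 : 1 + m * l / 2 <= expR (m * l / 2) by exact: expR_ge1Dx.
  have ml : 0 < m * l by exact: mulr_gt0.
  have e2 : 1 + (m * l) ^+ 2 / 4 <= expR (m * l / 2) ^+ 2.
    apply: (@le_trans _ _ ((1 + m * l / 2) ^+ 2)).
      have -> : (1 + m * l / 2) ^+ 2 = 1 + (m * l) ^+ 2 / 4 + m * l by field.
      lra.
    by apply: lerXn2r e1; rewrite nnegrE ?expR_ge0//; lra.
  have e3 : k * (s0 * (1 + (m * l) ^+ 2 / 4) - s0) <=
            k * (s0 * expR (m * l / 2) ^+ 2 - s0).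
    by rewrite ler_pM2l// lerD2r ler_pM2l.
  have e4 : k * (s0 * (1 + (m * l) ^+ 2 / 4) - s0) =
    k * s0 * m ^+ 2 * l / 4 * l by field.
  have e5 : B <= k * s0 * m ^+ 2 * l / 4.
    have : k * s0 * m ^+ 2 * L <= k * s0 * m ^+ 2 * l by rewrite ler_pM2l.
    have -> : k * s0 * m ^+ 2 * L = 4 * B by rewrite mulrC divfK// gt_eqF.
    by lra.
  have : B * l <= k * s0 * m ^+ 2 * l / 4 * l by rewrite ler_pM2r.
  by move: e3; rewrite e4 -/l; lra.
have wx : M < w x.
  rewrite wE qx lnqs -/sx [B * _]mulrC divfK ?gt_eqF//.
  by move: kX; lra.
have xeps : eps <= sqdist a x.
  rewrite leNgt; apply/negP => /ltW/weps.
  rewrite qx leNgt => /(_ qs_gt0)/negP; apply.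
  exact: lt_trans wx.
suff : w x <= u x by rewrite leNgt (le_lt_trans (uM _ xq) wx).
apply: (@comparison_annulus R n a K u _ _ _ _ eps q1 cK solu_C2 eps_gt0).
- move=> y /andP[ey yq1]; have Ky : ~ K y.
    by apply: Kq1; rewrite yq1 (lt_le_trans eps_gt0).
  by split=> //; exact: solu_gt0.
- move=> y [] yq; first by apply: weps; rewrite yq.
  by rewrite -/(w y) wE yq !subrr !mulr0 subrr.
- move=> y /andP[ey yq1] uwy.
  have y0 : 0 < sqdist a y by apply: lt_le_trans ey.
  have yq : 0 < sqdist a y <= q1 by rewrite y0.
  apply: lt_le_trans (solu_ge (Kq1 yq) (uM _ yq)).
  rewrite laplacian_barrier; last by rewrite -sqdist_eq0 gt_eqF.
  apply: (@lt_le_trans _ _ (sqdist a y `^ (-1) * M `^ (- p))).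
    have -> : 2 * (n%:R - 2) * (0 * sqdist a y `^ (- (n%:R / 2)) -
      - B * sqdist a y `^ (-1)) =
      sqdist a y `^ (-1) * (2 * (n%:R - 2) * B) by ring.
    by rewrite ltr_pM2l// powR_gt0.
  rewrite ler_pM2r//; apply: ger_powR.
    by rewrite y0 (le_trans yq1)// ltW.
  by move: ha; lra.
- by rewrite xeps; case/andP: xq.
Qed.

End Isolated.

End NecessaryConditions.

(** * Nonexistence near a C^2 boundary *)

Section BoundaryBarrier.
Context {R : realType} {n : nat}.
Variables (K : set 'rV[R]_n) (alpha p : R) (u : 'rV[R]_n -> R).
Hypotheses (n_gt2 : (2 < n)%N) (cK : closed K) (K_boundary : boundary K !=set0).
Hypotheses (alpha_lt0 : alpha < 0) (p_gt0 : 0 < p).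
Hypothesis solu : positive_C2_solution K alpha p u.

Local Notation m := (n%:R / 2 - 1 : R).

Let m_gt0 : 0 < m.
Proof.
have : 2 < n%:R :> R by rewrite ltr_nat.
lra.
Qed.

Lemma laplacian_ln (U : set 'rV[R]_n) (tau : 'rV[R]_n -> R) x :
  open U -> U x -> C2_on U tau -> (forall y, U y -> 0 < tau y) ->
  C2_on U (fun y => ln (tau y)) /\
  laplacian (fun y => ln (tau y)) x =
  laplacian tau x / tau x - (\sum_(i < n) partial i tau x ^+ 2) / tau x ^+ 2.
Proof.
move=> oU Ux Ct tau0.
have tauP y : U y -> [set t | 0 < t] (tau y) by exact: tau0.
have -> : (fun y => ln (tau y)) = (fun y => logpow 0 1 0 (tau y)).
  by apply/funext => y; rewrite /logpow powRr0 mulr1 mul1r add0r.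
split.
  apply: (C2_on_comp oU Ct tauP (is_derive_logpow _ _ _)
    (is_derive_logpow _ _ _)) => t t0.
  have [D _] := is_derive_logpow (0 * 1 + (0 - 1) * (1 + 0 * 0))
    ((0 - 1) * (0 * 1)) (0 - 1 - 1) t0.
  exact/differentiable_continuous/derivable1_diffP.
rewrite (laplacian_comp oU Ux Ct tauP (is_derive_logpow _ _ _)
  (is_derive_logpow _ _ _)).
rewrite /logpow powR_subr1 ?tau0// powR_subr1 ?tau0// powRr0.
by field; rewrite gt_eqF ?tau0.
Qed.

(** Here [tau] is a C^2 function which, on the part [tau > 0] of a ball,
dominates the distance to the boundary, has bounded gradient and has Laplacian
bounded below; the centre [a] is at positive distance from that part.
Then [- laplacian (ln tau) <= 2 C / tau^2], which is beaten by
[delta^alpha >= tau^(-2)]. *)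
Lemma no_solution_barrier (a x : 'rV[R]_n) (tau : 'rV[R]_n -> R) (q1 rho C : R) :
  alpha <= - 2 -> C2_on setT tau -> 0 < rho -> 0 <= C ->
  (forall y, sqdist a y <= q1 -> 0 < tau y ->
    [/\ ~ K y, delta K y <= tau y, tau y < 1 & rho <= sqdist a y] /\
    (\sum_(i < n) partial i tau y ^+ 2 <= C /\ - laplacian tau y <= C)) ->
  ~ (sqdist a x < q1 /\ 0 < tau x).
Proof.
move=> ha Ct rho0 C0 H [xq1 taux].
have [b Kb] := K_boundary.
have [Cu u0 _] := solu.
have [[Kx _ taux1 rhox] _] := H _ (ltW xq1) taux.
have ux := u0 _ Kx.
have q1_gt0 : 0 < q1 by apply: le_lt_trans xq1; exact: sqdist_ge0.
pose s1 := q1 `^ (- m); pose sx := sqdist a x `^ (- m).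
pose sr := rho `^ (- m).
have m0 := m_gt0.
have qx : 0 < sqdist a x by apply: lt_le_trans rhox.
have s1_gt0 : 0 < s1 by exact: powR_gt0.
have sr_gt0 : 0 < sr by exact: powR_gt0.
have sxs1 : 0 < sx - s1 by rewrite subr_gt0; apply: lt0_ltr_powR => //; lra.
pose A := 2 * u x / (sx - s1).
have A_gt0 : 0 < A by rewrite divr_gt0// mulr_gt0.
have AE : A * (sx - s1) = 2 * u x by rewrite divfK// gt_eqF.
have M_gt0 : 0 < (A * sr) `^ (- p) by rewrite powR_gt0// mulr_gt0.
have X0 : 0 <= A * - ln (tau x).
  by rewrite mulr_ge0 ?(ltW A_gt0)// oppr_ge0; apply: ln_le0; exact: ltW.
have Y0 : 0 <= A * (2 * C).
  by apply: mulr_ge0; [exact: ltW|exact: mulr_ge0].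
have [k k_gt0 [kX kY]] := exists_small ux M_gt0 X0 Y0.
(* Where tau <= eps the logarithm outweighs the bound sr on the harmonic
   part. *)
pose eps := expR (- (sr / k)).
have eps_gt0 : 0 < eps by exact: expR_gt0.
have keps : k * ln eps = - sr by rewrite expRK mulrN mulrC divfK// gt_eqF.
pose w y := barrier a (- (A * s1)) 0 A 0 y + A * k * ln (tau y).
have wE y : w y = A * (sqdist a y `^ (- m) - s1 + k * ln (tau y)).
  by rewrite /w barrierE; ring.
have wx : u x < w x.
  rewrite wE -/sx mulrDr AE.
  have -> : A * (k * ln (tau x)) = - (k * (A * - ln (tau x))) by ring.
  by lra.
have wq1 y : q1 <= sqdist a y -> tau y < 1 -> w y <= 0.
  move=> yq ty; rewrite wE pmulr_rle0//.
  have : sqdist a y `^ (- m) <= s1 by apply: le0_ler_powR => //; lra.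
  have : k * ln (tau y) <= 0 by rewrite pmulr_rle0//; apply: ln_le0; exact: ltW.
  lra.
have sr_ge y : rho <= sqdist a y -> sqdist a y `^ (- m) <= sr.
  by move=> yr; apply: le0_ler_powR => //; lra.
have weps y : rho <= sqdist a y -> 0 < tau y -> tau y <= eps -> w y <= 0.
  move=> /sr_ge yr t0 te; rewrite wE pmulr_rle0//.
  have : k * ln (tau y) <= - sr by rewrite -keps ler_pM2l//; exact: lt0_ler_ln.
  lra.
pose E := [set y | sqdist a y <= q1] `&` [set y | eps <= tau y].
have tc y : {for y, continuous tau} by have [[c _] _] := Ct; exact: c.
have oU0 : open [set y | 0 < tau y].
  apply: (@open_comp _ _ tau [set t | 0 < t]); last exact: open_gt.
  by move=> y _; exact: tc.
pose U := [set y | 0 < tau y] `&` ([set y | y != a] `&` ~` K).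
have oU : open U.
  apply: openI => //; apply: openI; [exact: open_punctured|exact: closed_openC].
have ET y : E y -> 0 < tau y by move=> [_ /= /(lt_le_trans eps_gt0)].
have EU : E `<=` U.
  move=> y Ey; have ty := ET _ Ey; case: Ey => /= yq1 _.
  have [[Ky _ _ yrho] _] := H _ yq1 ty; split => //; split => //=.
  by rewrite -sqdist_eq0 gt_eqF//; exact: lt_le_trans yrho.
have CtU : C2_on U tau by apply: C2_onW Ct.
have tauU y : U y -> 0 < tau y by case.
have CB : C2_on U (barrier a (- (A * s1)) 0 A 0).
  by apply: C2_on_barrier => // y [_ []].
have CL y : U y -> C2_on U (fun y => ln (tau y)).
  by move=> Uy; have [] := laplacian_ln oU Uy CtU tauU.
have Ex : E x.
  split; rewrite /= ?(ltW xq1)//.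
  rewrite leNgt; apply/negP => /ltW /(weps _ rhox taux).
  by rewrite leNgt => /negP; apply; exact: lt_trans wx.
have Ux := EU _ Ex.
suff : w x <= u x by rewrite leNgt wx.
apply: (@comparison R n U E u w oU); last exact: Ex.
- apply: (@compact_sqdist_le _ _ a q1); last by move=> y [].
  apply: closedI; first exact: closed_sqdist_le.
  apply: (@closed_comp _ _ tau [set t | eps <= t]); last exact: closed_ge.
  by move=> y _; exact: tc.
- exact: EU.
- by apply: C2_onW Cu => y [_ []].
- exact: C2_onD oU CB (C2_onZ _ oU (CL _ Ux)).
- by move=> y /EU[_ [_]]; exact: u0.
- move=> y Ey wy; have ty := ET _ Ey; case: (Ey) => /= yq1 ye.
  have [[Ky _ ty1 yrho] _] := H _ yq1 ty.
  have yq1' : sqdist a y < q1.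
    by rewrite ltNge; apply/negP => /wq1/(_ ty1); rewrite leNgt wy.
  have ye' : eps < tau y.
    by rewrite ltNge; apply/negP => /(weps _ yrho ty); rewrite leNgt wy.
  pose V := [set t | sqdist a t < q1] `&` [set t | eps < tau t].
  have oV : open V.
    apply: openI.
      apply: (@open_comp _ _ (sqdist a) [set t | t < q1]); last exact: open_lt.
      by move=> t _; exact: sqdist_cts.
    apply: (@open_comp _ _ tau [set t | eps < t]); last exact: open_gt.
    by move=> t _; exact: tc.
  have VE : V `<=` E by move=> t [/= /ltW ? /ltW ?].
  by move: VE; rewrite open_subsetE//; apply.
- move=> y Ey wy uwy; have Uy := EU _ Ey; have ty := ET _ Ey.
  case: Ey => /= yq1 _.
  have [[Ky dy ty1 yrho] [hS hL]] := H _ yq1 ty.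
  have uM : u y <= A * sr.
    apply: (@le_trans _ _ (w y)); first exact: ltW.
    rewrite wE ler_pM2l//; have := sr_ge _ yrho.
    have : k * ln (tau y) <= 0.
      by rewrite pmulr_rle0//; apply: ln_le0; exact: ltW.
    by lra.
  have := solution_ge_delta cK (ltW alpha_lt0) p_gt0 solu Kb Ky dy uM.
  apply: lt_le_trans.
  rewrite (laplacianD oU Uy CB (C2_onZ _ oU (CL _ Uy))).
  rewrite (laplacianZ _ oU Uy (CL _ Uy)) opprD laplacian_barrier; last first.
    by case: Uy => _ [].
  rewrite !mul0r subrr mulr0 add0r (laplacian_ln oU Uy CtU tauU).2.
  apply: (@lt_le_trans _ _ (tau y `^ (- 2) * (A * sr) `^ (- p))); last first.
    rewrite ler_pM2r//; apply: ger_powR => //.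
    by rewrite ty ltW.
  have -> : tau y `^ (- 2) = (tau y ^+ 2)^-1 by rewrite powR_invn// ltW.
  rewrite [ltRHS]mulrC ltr_pdivlMr ?exprn_gt0//.
  apply: le_lt_trans kY.
  set S := \sum_(i < n) _ in hS *; set L := laplacian tau y in hL *.
  have -> : - (A * k * (L / tau y - S / tau y ^+ 2)) * tau y ^+ 2 =
     k * (A * (S + - L * tau y)) by field; rewrite gt_eqF.
  rewrite ler_pM2l// ler_pM2l//.
  have : - L * tau y <= C * tau y by rewrite ler_pM2r.
  have : C * tau y <= C * 1 by rewrite ler_wpM2l// ltW.
  by lra.
Qed.

End BoundaryBarrier.

(** * The graph function of a C^2 domain and isolated components *)

Section GraphFunction.
Context {R : realType} {n : nat}.
Variables (i : 'I_n) (b : bool) (g : 'rV[R]_n.-1 -> R).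
Hypothesis Cg : C2_on setT g.

Local Notation e_ j := (delta_mx ord0 j : 'rV[R]_n).

(** Signed distance to the graph of [g] along the [i]-th axis: near the boundary
point the domain is [graph_gap < 0]. *)
Definition graph_gap (x : 'rV[R]_n) : R := g (col' i x) - (-1) ^+ b * x ord0 i.

Lemma col'_continuous (x : 'rV[R]_n) :
  {for x, continuous (fun y : 'rV[R]_n => col' i y : 'rV[R]_n.-1)}.
Proof.
move=> A /nbhs_ballP[e /= e0 eA].
suff : nbhs x (ball x e).
  by apply: filterS => y [_ xy]; apply: eA; split => // j k; rewrite !mxE.
exact: nbhsx_ballx.
Qed.

(** The partial derivatives of [f] composed with the removal of the [i]-th
coordinate: [unlift i j] is the index of [j] among the remaining coordinates. *)
Definition partial_col' (f : 'rV[R]_n.-1 -> R) (j : 'I_n) (x : 'rV[R]_n) : R :=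
  if unlift i j is Some k then partial k f (col' i x) else 0.

Lemma is_derive_col' (f : 'rV[R]_n.-1 -> R) j x : C1_on setT f ->
  is_derive x (e_ j) (fun y => f (col' i y)) (partial_col' f j x).
Proof.
move=> Cf; apply/is_derive_lineP.
have -> : (fun h : R => f (col' i (h *: e_ j + x))) =
          (fun h : R => f (h *: col' i (e_ j) + col' i x)).
  by apply/funext => h; rewrite linearP.
rewrite /partial_col'; case: unliftP => [k ->|->].
  have -> : col' i (e_ (lift i k)) = delta_mx ord0 k :> 'rV[R]_n.-1.
    by apply/rowP => l; rewrite !mxE (inj_eq lift_inj).
  by have /is_derive_lineP := C1_on_is_derive k Cf (I : setT (col' i x)).
have -> : col' i (e_ i) = 0 :> 'rV[R]_n.-1.
  by apply/rowP => l; rewrite !mxE [lift _ _ == _]eq_sym (negbTE (neq_lift _ _)) andbF.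
by have /is_derive_lineP := is_derive0 f (col' i x).
Qed.

Lemma C0_on_col' (f : 'rV[R]_n.-1 -> R) : C0_on setT f ->
  C0_on setT (fun x : 'rV[R]_n => f (col' i x)).
Proof.
by move=> cf x _; apply: continuous_comp; [exact: col'_continuous|exact: cf].
Qed.

Lemma C1_on_col' (f : 'rV[R]_n.-1 -> R) : C1_on setT f ->
  C1_on setT (fun x : 'rV[R]_n => f (col' i x)).
Proof.
move=> Cf; have [f0 f1] := Cf.
refine (@C1_on_intro _ _ _ _ (partial_col' f) openT (C0_on_col' f0) _ _).
  by move=> j x _; exact: is_derive_col'.
move=> j; rewrite /partial_col'; case: unliftP => [k _|_].
  by apply: C0_on_col'; have [] := f1 k.
by move=> x _; exact: cst_continuous.
Qed.

Lemma C2_on_col' (f : 'rV[R]_n.-1 -> R) : C2_on setT f ->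
  C2_on setT (fun x : 'rV[R]_n => f (col' i x)).
Proof.
move=> [f1 f2].
refine (@C2_on_intro _ _ _ _ (partial_col' f) openT (C0_on_col' f1.1) _ _).
  by move=> j x _; exact: is_derive_col'.
move=> j; rewrite /partial_col'; case: unliftP => [k _|_].
  exact: C1_on_col'.
exact: C1_on_cst openT.
Qed.

Lemma C2_on_graph_gap : C2_on setT graph_gap.
Proof.
have Ci : C2_on setT (fun x : 'rV[R]_n => x ord0 i).
  refine (@C2_on_intro _ _ _ _ (fun j _ => (e_ j) ord0 i) openT _ _ _).
  - by move=> x _; exact: coord_cts.
  - by move=> j x _; exact: is_derive_coord.
  - by move=> j; exact: C1_on_cst openT.
have H := C2_onD openT (C2_on_col' Cg) (C2_onZ (- (-1) ^+ b) openT Ci).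
suff -> : graph_gap = (fun x => g (col' i x) + - (-1) ^+ b * x ord0 i) by [].
by apply/funext => x; rewrite /graph_gap mulNr.
Qed.

Lemma graph_gap_shift (x : 'rV[R]_n) (t : R) :
  graph_gap (x + (t * (-1) ^+ b) *: e_ i) = graph_gap x - t.
Proof.
rewrite /graph_gap.
have -> : col' i (x + (t * (-1) ^+ b) *: e_ i) = col' i x.
  apply/rowP => l; rewrite !mxE [lift _ _ == _]eq_sym (negbTE (neq_lift _ _)) andbF mulr0.
  by rewrite addr0.
rewrite !mxE !eqxx mulr1 mulrDr [(-1) ^+ b * (t * _)]mulrC -mulrA.
by rewrite -expr2 sqrr_sign mulr1; ring.
Qed.

Lemma sqdist_shift (x : 'rV[R]_n) (t : R) :
  sqdist x (x + (t * (-1) ^+ b) *: e_ i) = t ^+ 2.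
Proof. by rewrite sqdist_line exprMn sqrr_sign mulr1. Qed.

End GraphFunction.

Section Components.
Context {R : realType} {n : nat}.
Implicit Types (x y z : 'rV[R]_n) (K C : set 'rV[R]_n).

(** When there are finitely many components, [K] coincides near a point with the
component of that point. *)
Lemma component_nbhs K C z : closed K -> finite_set (components K) ->
  components K C -> C z ->
  exists V, [/\ open V, V z & V `&` K `<=` C].
Proof.
move=> cK fK KC Cz; pose F := \bigcup_(D in components K `\` [set C]) D.
have cF : closed F.
  apply: closed_bigcup; first exact: finite_setD.
  by move=> _ [[x Kx <-] _]; exact: component_closed.
exists (~` F); split; first exact: closed_openC.
  move=> [_ [[y Ky <-] neC] yz]; apply: neC.
  move: KC Cz => [x Kx <-] xz /=.
  by rewrite (same_connected_component xz) (same_connected_component yz).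
move=> x [Fx Kx]; apply: contrapT => Cx; apply: Fx.
exists (connected_component K x); last exact: connected_component_refl.
split; first by exists x.
by move=> /= xC; apply: Cx; rewrite -xC; exact: connected_component_refl.
Qed.

Lemma sqdist_triangle x y z : sqdist x z <= 2 * sqdist x y + 2 * sqdist y z.
Proof.
rewrite /sqdist !mulr_sumr -big_split /=; apply: ler_sum => k _.
set s := x ord0 k; set t := y ord0 k; set r := z ord0 k.
have := sqr_ge0 (s + r - 2 * t); rewrite !expr2; lra.
Qed.

End Components.

(** * No solution around the closure of a C^2 domain *)

Section C2Part.
Context {R : realType} {n : nat}.
Implicit Types (x y z : 'rV[R]_n) (K D : set 'rV[R]_n).

Lemma no_solution_C2_component K D (alpha p : R) (u : 'rV[R]_n -> R) :
  (2 < n)%N -> compact K -> finite_set (components K) ->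
  components K (closure D) -> C2_domain D -> alpha <= - 2 -> 0 < p ->
  ~ positive_C2_solution K alpha p u.
Proof.
move=> n_gt2 kK fK KD [oD _ [d Dd] Dgraph] ha p_gt0 solu.
have n_gt0 : (0 < n)%N by case: (n) n_gt2.
have shift_gt0 (e : R) : 0 < e -> 0 < 0 - e - - (3 / 2 * e) by lra.
have coef_lt : (3 / 2) ^+ 2 < 4 :> R by lra.
have quarter_lt (e : R) : 0 < e -> e / 4 < e by lra.
have cK : closed K by apply: compact_closed kK; exact: norm_hausdorff.
have DK : closure D `<=` K.
  by case: KD => x _ <-; exact: connected_component_sub.
have kD : compact (closure D).
  by apply: subclosed_compact kK DK; exact: closed_closure.
have [z [Dz nDz]] : boundary D !=set0.
  have [z [z1 z2]] : boundary (closure D) !=set0.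
    apply: boundary_nonempty n_gt0 kD _.
    by exists d; exact: subset_closure.
  exists z; split; first by move: z1; rewrite -(closure_id _).1//; exact: closed_closure.
  by move=> h; apply: z2; move: h; apply: interiorS; exact: subset_closure.
have [i [b [g [Cg Dg]]]] := Dgraph _ (conj Dz nDz).
pose tau := graph_gap i b g.
have Ct : C2_on setT tau by exact: C2_on_graph_gap.
have tc y : {for y, continuous tau} by have [[c _] _] := Ct; exact: c.
have [V [oV Vz VK]] := component_nbhs cK fK KD Dz.
have [r r_gt0 rP] : exists2 r : R, 0 < r & forall x, sqdist z x < r ->
    (D x <-> tau x < 0) /\ (K x -> closure D x).
  have nV : nbhs z V by exact: open_nbhs_nbhs.
  have [r1 r1_gt0 r1P] := nbhs_sqdist Dg.
  have [r2 r2_gt0 r2P] := nbhs_sqdist nV.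
  exists (Num.min r1 r2); first by rewrite lt_min r1_gt0.
  move=> x; rewrite lt_min => /andP[/r1P Dx /r2P Vx]; split.
    by rewrite Dx /tau /graph_gap subr_lt0.
  by move=> Kx; apply: VK.
(* Near z the points above the graph are outside K, and z is on the graph. *)
have tau_pos x : sqdist z x < r -> 0 < tau x -> ~ K x.
  move=> xr tx; have [_ KDx] := rP _ xr; move=> /KDx Dx.
  have oU : open ([set y | 0 < tau y] `&` [set y | sqdist z y < r]).
    apply: openI.
      by apply: (@open_comp _ _ tau [set t | 0 < t]);
        [move=> y _; exact: tc|exact: open_gt].
    by apply: (@open_comp _ _ (sqdist z) [set t | t < r]);
      [move=> y _; exact: sqdist_cts|exact: open_lt].
  have [y [Dy [ty yr]]] := Dx _ (open_nbhs_nbhs (conj oU (conj tx xr))).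
  have := (rP _ yr).1.1 Dy; have ty0 : 0 < tau y := ty.
  by rewrite ltNge ltW.
have zz : sqdist z z < r.
  by have /eqP -> : sqdist z z == 0 by rewrite sqdist_eq0.
have tz : tau z = 0.
  apply/eqP; rewrite eq_le; apply/andP; split; rewrite leNgt; apply/negP => tz.
    by apply: tau_pos tz (DK _ Dz).
  by apply: nDz; move: oD; rewrite openE; apply; apply/(rP _ zz).1.
(* Translation along the distinguished axis changes tau by the same amount. *)
pose sh x (t : R) := x + (t * (-1) ^+ b) *: delta_mx ord0 i.
have tsh x t : tau (sh x t) = tau x - t by exact: graph_gap_shift.
have qsh x t : sqdist x (sh x t) = t ^+ 2 by exact: sqdist_shift.
have bdK y : sqdist z y < r -> tau y = 0 -> boundary K y.
  move=> yr ty.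
  have oB : open [set x | sqdist z x < r].
    by apply: (@open_comp _ _ (sqdist z) [set t | t < r]);
      [move=> x _; exact: sqdist_cts|exact: open_lt].
  have nB : nbhs y [set x | sqdist z x < r] by exact: open_nbhs_nbhs.
  have [r1 r1_gt0 r1P] := nbhs_sqdist nB.
  split.
    apply: closureS DK _ _; rewrite /closure /= => B /nbhs_sqdist[r2 r2_gt0 r2P].
    pose h := Num.sqrt (Num.min r1 r2) / 2.
    have m_gt0 : 0 < Num.min r1 r2 by rewrite lt_min r1_gt0.
    have s0 : 0 < Num.sqrt (Num.min r1 r2) by rewrite sqrtr_gt0.
    have h0 : 0 < h by rewrite /h; lra.
    have : sqdist y (sh y h) < Num.min r1 r2.
      rewrite qsh -[ltRHS]sqr_sqrtr ?ltW// ltr_pXn2r ?nnegrE ?ltW//.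
      by rewrite /h; lra.
    rewrite lt_min => /andP[/r1P h1 /r2P h2].
    exists (sh y h); split => //; apply: subset_closure.
    by apply/(rP _ h1).1; rewrite tsh ty; lra.
  move=> /nbhs_sqdist[r2 r2_gt0 r2P].
  pose h := Num.sqrt (Num.min r1 r2) / 2.
  have m_gt0 : 0 < Num.min r1 r2 by rewrite lt_min r1_gt0.
  have s0 : 0 < Num.sqrt (Num.min r1 r2) by rewrite sqrtr_gt0.
  have h0 : 0 < h by rewrite /h; lra.
  have : sqdist y (sh y (- h)) < Num.min r1 r2.
    rewrite qsh sqrrN -[ltRHS]sqr_sqrtr ?ltW// ltr_pXn2r ?nnegrE ?ltW//.
    by rewrite /h; lra.
  rewrite lt_min => /andP[/r1P h1 /r2P h2].
  by apply: tau_pos h1 _ h2; rewrite tsh ty; lra.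
(* The vertical projection of x onto the graph is a boundary point of K. *)
have dle x : sqdist z x < r / 4 -> 0 < tau x -> tau x ^+ 2 < r / 4 ->
    delta K x <= tau x.
  move=> xr tx tr.
  have yr : sqdist z (sh x (tau x)) < r.
    apply: le_lt_trans (sqdist_triangle z x _) _; rewrite qsh; lra.
  have := delta_le x (bdK _ yr _); rewrite sqdistC qsh sqrtr_sqr gtr0_norm//.
  by apply; rewrite tsh subrr.
pose S x := \sum_(j < n) partial j tau x ^+ 2.
pose L x := - 1 * laplacian tau x.
have Sc : {for z, continuous S}.
  have [[_ t1] _] := Ct.
  suff H : C0_on setT S by exact: H.
  apply: C0_on_sum => j; under eq_fun do rewrite expr2.
  by have [_ tj] := t1 j; exact: (C0_onM tj tj).
have Lc : {for z, continuous L}.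
  have [_ t2] := Ct.
  suff H : C0_on setT L by exact: H.
  apply: C0_onM; first by move=> x _; exact: cst_continuous.
  by apply: C0_on_sum => j; have [_ /(_ j)[]] := t2 j.
pose C := S z + `|L z| + 1.
have Sz0 : 0 <= S z by apply: sumr_ge0 => j _; exact: sqr_ge0.
have Lz0 := normr_ge0 (L z).
have Lz1 := ler_norm (L z).
pose tm := Num.min 1 (Num.sqrt r / 2).
have sr_gt0 : 0 < Num.sqrt r by rewrite sqrtr_gt0.
have tm_gt0 : 0 < tm by rewrite lt_min ltr01 divr_gt0.
have op (f : 'rV[R]_n -> R) (c : R) : {for z, continuous f} -> f z < c ->
    exists2 r' : R, 0 < r' & forall x, sqdist z x < r' -> f x < c.
  move=> cf fc.
  have nc : nbhs (f z) [set t | t < c].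
    by apply: open_nbhs_nbhs; split; [exact: open_lt|].
  exact: (nbhs_sqdist (cf _ nc)).
have [r1 r1_gt0 r1P] := op S C Sc ltac:(rewrite /C; lra).
have [r2 r2_gt0 r2P] := op L C Lc ltac:(rewrite /C; lra).
have [r3 r3_gt0 r3P] := op tau tm (tc z) ltac:(by rewrite tz).
pose r4 := Num.min (Num.min r1 r2) (Num.min r3 (r / 4)).
have r4_gt0 : 0 < r4 by rewrite !lt_min r1_gt0 r2_gt0 r3_gt0 divr_gt0.
(* The ball of centre a = sh z eta and radius 2 eta lies in the ball
   of squared radius 10 eta^2 < r4 around z, and contains z in its interior. *)
pose eta := Num.sqrt r4 / 4.
have s4_gt0 : 0 < Num.sqrt r4 by rewrite sqrtr_gt0.
have eta_gt0 : 0 < eta by rewrite divr_gt0.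
have etaE : eta ^+ 2 = r4 / 16.
  by rewrite /eta expr_div_n sqr_sqrtr ?ltW//; congr (_ / _); ring.
pose a := sh z eta.
have [rho rho_gt0 rhoP] : exists2 r' : R, 0 < r' & forall x, sqdist a x < r' ->
    tau x < 0.
  have nc : nbhs (tau a) [set t | t < 0].
    apply: open_nbhs_nbhs; split; first exact: open_lt.
    by rewrite /= tsh tz; lra.
  exact: (nbhs_sqdist (tc a _ nc)).
pose x := sh z (- (eta / 2)).
have alpha_lt0 : alpha < 0 by lra.
have K_boundary : boundary K !=set0 by exists z; exact: bdK.
apply: (@no_solution_barrier R n K alpha p u n_gt2 cK K_boundary alpha_lt0
  p_gt0 solu a x tau (4 * eta ^+ 2) rho C ha Ct rho_gt0).
- by rewrite /C; lra.
- move=> y ya ty.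
  have : sqdist z y < r4.
    have za : sqdist z a = eta ^+ 2 by exact: qsh.
    apply: le_lt_trans (sqdist_triangle z a y) _; rewrite za; move: ya.
    by rewrite etaE; lra.
  rewrite !lt_min => /andP[/andP[/r1P Sy /r2P Ly] /andP[/r3P ty1 yr]].
  have yr' : sqdist z y < r := lt_trans yr (quarter_lt _ r_gt0).
  split; last by split; [exact: ltW|move: Ly; rewrite /L mulN1r => /ltW].
  move: ty1; rewrite lt_min => /andP[ty1 tyr].
  split => //; first exact: tau_pos.
  - apply: dle => //.
    have -> : r / 4 = (Num.sqrt r / 2) ^+ 2.
      by rewrite expr_div_n sqr_sqrtr ?ltW//; congr (_ / _); ring.
    by rewrite ltr_pXn2r ?nnegrE ?ltW// divr_gt0.
  - by rewrite leNgt; apply/negP => /rhoP /(lt_trans ty); rewrite ltxx.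
- have -> : x = sh a (- (3 / 2 * eta)).
    rewrite /x /a /sh -addrA -scalerDl; congr (_ + _ *: _).
    by rewrite -mulrDl; congr (_ * _); field.
  rewrite qsh sqrrN exprMn tsh tsh tz; split; last exact: shift_gt0.
  by rewrite ltr_pM2r ?exprn_gt0.
Qed.

End C2Part.

(** * Existence for finite sets, and conclusion *)

Section Existence.
Context {R : realType} {n : nat}.

Lemma solution_exists (K : set 'rV[R]_n) (alpha p : R) : (2 < n)%N ->
  compact K -> finite_set K -> boundary K !=set0 -> 0 < p ->
  0 < n%:R + alpha + p * (n%:R - 2) -> alpha < - 2 ->
  exists u, positive_C2_solution K alpha p u.
Proof.
move=> n_gt2 kK fK [b Kb] p0 hp ha.
have cK : closed K by apply: compact_closed kK; exact: norm_hausdorff.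
have K0 : K !=set0 by exists b; exact: boundary_sub Kb.
have [s sE] := (finite_seqP K).1 fK.
have sK a : (a \in s) <-> K a by rewrite sE.
(* gamma is determined by matching the powers of the distance on both sides. *)
pose gamma := - (alpha + 2) / (1 + p).
have p1 : 0 < 1 + p by lra.
have g0 : 0 < gamma by rewrite divr_gt0//; lra.
have gE : gamma * (1 + p) = - (alpha + 2) by rewrite divfK// gt_eqF.
have g1 : gamma < n%:R - 2 by rewrite ltr_pdivrMr//; lra.
pose c := gamma * (n%:R - 2 - gamma).
have c0 : 0 < c by rewrite mulr_gt0// subr_gt0.
pose e := - (gamma / 2).
pose C := 1 + c^-1.
have ci0 : 0 < c^-1 by rewrite invr_gt0.
have C1 : 1 <= C by rewrite /C; lra.
have C0 : 0 < C by apply: lt_le_trans C1.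
have Cc : 1 <= C * c by rewrite /C mulrDl mul1r mulVf ?gt_eqF//; lra.
pose F (a x : 'rV[R]_n) := logpow 1 0 e (sqdist a x).
have FE a x : F a x = sqdist a x `^ e by rewrite /F /logpow mul0r addr0 mul1r.
pose u x := C * \sum_(a <- s) F a x.
have oU : open (~` K) by exact: closed_openC.
have sU a : a \in s -> ~` K `<=` [set x | x != a].
  by move=> /sK Ka x Kx; apply/eqP => xa; apply: Kx; rewrite xa.
have CF a : a \in s -> C2_on (~` K) (F a).
  by move=> /sU aU; apply: C2_onW aU _; exact: C2_on_logpow.
(* A nearest point of K; the boundary is contained in K, hence is not closer. *)
have near_pt x : ~ K x -> exists a0, [/\ a0 \in s, 0 < sqdist a0 x &
    Num.sqrt (sqdist a0 x) <= delta K x].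
  move=> Kx.
  have cq : {within K, continuous (fun y : 'rV[R]_n => sqdist y x)}.
    apply: continuous_in_subspaceT => y _.
    by under eq_fun do rewrite sqdistC; exact: sqdist_cts.
  have [a0 /set_mem Ka0 a0min] := compact_EVT_min K0 kK cq.
  exists a0; split; first exact/sK.
    by apply: sqdist_gt0; apply/eqP => xa; apply: Kx; rewrite xa.
  apply: lb_le_inf; first by exists (eucl_norm (x - b)), b.
  move=> _ [y /(boundary_sub cK) Ky <-]; rewrite eucl_normE.
  by rewrite ler_wsqrtr//; apply: a0min; exact/mem_set.
have sum_ge (G : 'rV[R]_n -> R) a0 : a0 \in s -> (forall a, 0 <= G a) ->
    G a0 <= \sum_(a <- s) G a.
  by move=> sa G0; rewrite (big_rem a0)//= lerDl; exact: sumr_ge0.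
have u_ge x a0 : a0 \in s -> C * sqdist a0 x `^ e <= u x.
  move=> sa; rewrite /u ler_pM2l// -FE.
  by apply: (sum_ge (fun a => F a x)) => // a; rewrite FE powR_ge0.
exists u; split.
- exact: C2_onZ oU (C2_on_sum oU CF).
- move=> x Kx; have [a0 [sa q0 _]] := near_pt _ Kx.
  by apply: lt_le_trans (u_ge _ _ sa); rewrite mulr_gt0// powR_gt0.
- move=> x Kx; have [a0 [sa q0 dx]] := near_pt _ Kx.
  set q := sqdist a0 x in q0 dx.
  have qs0 : 0 < Num.sqrt q by rewrite sqrtr_gt0.
  rewrite (laplacianZ _ oU Kx (C2_on_sum oU CF)) (laplacian_sum oU Kx CF).
  have -> : \sum_(a <- s) laplacian (F a) x =
            - \sum_(a <- s) c * sqdist a x `^ (e - 1).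
    rewrite -sumrN; apply: eq_big_seq => a /sU/(_ _ Kx) /= xa.
    rewrite laplacian_logpow// mul0r addr0 mulr1 mulr0 addr0 -mulNr.
    by congr (_ * _); rewrite /e /c; field.
  rewrite mulrN opprK.
  apply: (@le_trans _ _ (C * (c * q `^ (e - 1)))); last first.
    rewrite ler_pM2l//; apply: (sum_ge (fun a => c * sqdist a x `^ (e - 1))) => // a.
    by rewrite mulr_ge0 ?powR_ge0// ltW.
  apply: (@le_trans _ _ (q `^ (alpha / 2) * (C * q `^ e) `^ (- p))).
    apply: ler_pM; rewrite ?powR_ge0//.
      rewrite -(powR_sqrt alpha (ltW q0)); apply: (le0_ler_powR _ qs0 dx); lra.
    apply: le0_ler_powR; [lra|by rewrite mulr_gt0// powR_gt0|exact: u_ge].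
  rewrite powRM ?powR_ge0//; last exact: ltW.
  rewrite -powRrM mulrCA -powRD; last by rewrite (gt_eqF q0) implybT.
  have -> : alpha / 2 + e * - p = e - 1.
    rewrite /e; have -> : alpha = - 2 - gamma * (1 + p) by rewrite gE; ring.
    by field.
  rewrite mulrA ler_wpM2r ?powR_ge0//; apply: le_trans Cc.
  have : C `^ (- p) <= C `^ 0 by apply: ler_powR => //; lra.
  by rewrite powRr0.
Qed.

End Existence.

Theorem corollary1p5 (R : realType) (N : nat) (hN : (3 <= N)%N)
    (K K1 K2 : set 'rV[R]_N)
    (K_nonempty : K !=set0) (K_compact : compact K)
    (K_components : finite_set (components K))
    (K1_def : K1 = C2_part K) (K2_def : K2 = isolated K)
    (K_decomp : K = K1 `|` K2)
    (alpha p : R) (alpha_lt0 : alpha < 0) (p_gt0 : 0 < p) :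
  (K1 !=set0 -> ~ exists u, positive_C2_solution K alpha p u) /\
  (K1 = set0 ->
     ((exists u, positive_C2_solution K alpha p u) <->
      (0 < N%:R + alpha + p * (N%:R - 2) /\ alpha < - 2)) /\
     (forall u, positive_C2_solution K alpha p u ->
        forall a, K2 a -> singular_at K u a)).
Proof.
have N_gt0 : (0 < N)%N by case: (N) hN.
have cK : closed K by apply: compact_closed K_compact; exact: norm_hausdorff.
have [b Kb] := boundary_nonempty N_gt0 K_compact K_nonempty.
have alpha_ltN2 u : positive_C2_solution K alpha p u -> alpha < - 2.
  move=> solu.
  have cq : {within K, continuous (sqdist b)}.
    by apply: continuous_in_subspaceT => y _; exact: sqdist_cts.
  have [z _ zmax] := compact_EVT_max K_nonempty K_compact cq.
  apply: (@solution_alpha_ltN2 R N K alpha p u b hN cK Kb alpha_lt0 p_gt0 solu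
    (sqdist b z + 1)) => x Kx.
  by apply: le_lt_trans (zmax _ (mem_set Kx)) _; rewrite ltrDl.
split.
  move=> [z]; rewrite K1_def => -[C [KC [D CD CE]] _] [u solu].
  rewrite CE in KC.
  apply: (no_solution_C2_component hN K_compact K_components KC CD _ p_gt0 solu).
  exact/ltW/(alpha_ltN2 u).
move=> K1_0.
have K_iso : K = isolated K by rewrite {1}K_decomp K1_0 set0U K2_def.
have punctured a : K a -> exists r : R, [/\ 0 < r, boundary K a &
    forall x, x != a -> sqdist a x < r -> ~ K x].
  rewrite {1}K_iso => Ka; have [r r0 rK] := isolated_sqdist Ka.
  by exists r; split => //; exact: isolated_boundary.
split.
  split=> [[u solu]|[hp ha]].
    split; last exact: alpha_ltN2 solu.
    have [r [r0 _ rK]] := punctured b (boundary_sub cK Kb).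
    exact: (solution_exponent_gt0 hN cK Kb alpha_lt0 p_gt0 solu r0 rK).
  apply: solution_exists => //; last by exists b.
  exact: compact_isolated_finite.
move=> u solu a; rewrite K2_def -K_iso => /punctured[r [r0 Ka rK]] [v [vu vc]].
have nv : nbhs (v a) [set t | t < v a + 1].
  by apply: open_nbhs_nbhs; split; [exact: open_lt|rewrite /= ltrDl].
have [r1 r1_gt0 r1P] := nbhs_sqdist (vc _ nv).
have m_gt0 : 0 < Num.min r r1 by rewrite lt_min r0 r1_gt0.
have mK x : x != a -> sqdist a x < Num.min r r1 -> ~ K x.
  by move=> xa; rewrite lt_min => /andP[xr _]; exact: rK xr.
apply: (solution_unbounded hN cK Ka alpha_lt0 p_gt0 solu m_gt0 mK (M := v a + 1)).
  exact/ltW/(alpha_ltN2 u).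
move=> x /andP[x0 xm].
have Kx : ~ K x by apply: mK xm; rewrite -sqdist_eq0 gt_eqF.
rewrite -vu//; apply/ltW/r1P; move: xm.
by rewrite lt_min => /andP[].
Qed.
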